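(* Let $k\geq 3$ and assume that $N$ is sufficiently large in terms of $k$. There exists a constant $c_k>0$ such that the following holds. Let $$(\log N)^{1/c_k}\leq B\leq \exp\bigl((\log N)^{c_k}\bigr),$$ and let $A\subseteq\{p\leq N: p\text{ prime}\}$ satisfy $$|A|\geq\frac{\pi(N)}{(\log N)^{c_k}}.$$ Then, for all but an $O_k((\log N)^{-c_k})$ proportion of tuples $\mathbf b=(b_1,\ldots,b_k)\in((B/2,B]\cap\mathbb Z)^k$, the set $A$ contains a configuration $$x+b_1m,\ x+b_2m,\ \ldots,\ x+b_km\qquad\text{with }x\in\mathbb Z,\ m\in[N/B].$$
   Context: For a real number $X\geq1$, $[X]=\{1,2,\ldots,\lfloor X\rfloor\}$, and $\pi(N)$ is the number of primes at most $N$. The constant $c_k$ depends only on $k$, and $O_k(\cdot)$ denotes an implied constant depending only on $k$. *)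

(* Defs.v *)
From mathcomp Require Import all_boot all_order all_algebra.
From mathcomp Require Import finmap.
From mathcomp Require Import all_classical all_reals all_analysis.

Set Implicit Arguments.
Unset Strict Implicit.
Unset Printing Implicit Defensive.

Import Order.TTheory GRing.Theory Num.Theory.
Local Open Scope ring_scope.

Definition primes_upto (R : realType) (N : R) : {fset nat} :=
  [fset p in iota 0 (Num.truncn N).+1 | prime p && (p%:R <= N)]%fset.

Definition prime_pi (R : realType) (N : R) : nat := #|` primes_upto N|%fset.

(* The tuples of ((B/2, B] cap Z)^k. For 0 <= B the integers of (B/2, B] are
   natural numbers at most [Num.truncn B], so nothing is lost by taking the
   entries in an ordinal type. *)
Definition dyadic_tuples (R : realType) (k : nat) (B : R) :
    {set {ffun 'I_k -> 'I_(Num.truncn B).+1}} :=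
  [set b : {ffun 'I_k -> 'I_(Num.truncn B).+1} |
     [forall i, (B / 2 < (b i : nat)%:R) && ((b i : nat)%:R <= B)]]%SET.

Definition contains_config (R : realType) (k n : nat) (A : {fset nat}) (X : R)
    (b : {ffun 'I_k -> 'I_n}) : Prop :=
  exists (x : int) (m : nat),
    [/\ (0 < m)%N, m%:R <= X &
        forall i : 'I_k,
          exists2 p : nat, p \in A & p%:Z = x + (b i : nat)%:Z * m%:Z].

Definition bad_tuples (R : realType) (k : nat) (A : {fset nat}) (N B : R) :
    {set {ffun 'I_k -> 'I_(Num.truncn B).+1}} :=
  [set b in dyadic_tuples k B | ~~ `[< contains_config A (N / B) b >]]%SET.

(* Main.v *)
Require Import Defs.
From mathcomp Require Import all_boot all_order all_algebra.
From mathcomp Require Import finmap.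
From mathcomp Require Import all_classical all_reals all_analysis.
From mathcomp Require Import ring lra zify.

(** Idea. Greedy density increment: inside [0, N] pass from one arithmetic
    progression {a + W i : i < n} to a subprogression of step W h with
    1 <= h <= B whenever the density of A grows by a factor 1 + eps.  The density
    starts above (log N)^(-1-2c), so after few steps one reaches a progression
    all of whose subprogressions of such steps and of length M ~ n/(B K) have
    density at most (1 + eps) times its own density rho.

    For b in (B/2, B] let S_b be the set of pairs (x, m), m <= M, such that
    x + b m is the index of an element of A.  All S_b have the same size, and
    the absence of an increment in step W |b - b'| gives
    |S_b /\ S_b'| <= (1 + O(eps)) rho^2 (number of pairs): the S_b are nearly
    pairwise independent from above.  A configuration for (b_1, ..., b_k) exists
    unless S_{b_1}, ..., S_{b_k} have no common element, and this is rare by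
    Chebyshev's inequality: the second moment of |S_{b_1} /\ ... /\ S_{b_k}| is
    the k-th moment of g(w, w') = #{b : w, w' in S_b}, and g is concentrated
    in L^2 by pairwise independence, while its moment of order 2(k-1), which
    counts (2k-2)-tuples of primes, is bounded up to a small power of log N by
    Brun's pure sieve.  The power of log N gained from eps beats that loss. *)

Set Implicit Arguments.
Unset Strict Implicit.
Unset Printing Implicit Defensive.

Import Order.TTheory GRing.Theory Num.Theory.
Local Open Scope ring_scope.

(** * The second moment method *)

(** The difference [v ^ t - v ^_ t] counts the non-injective [t]-tuples from [v] values. Extending
    an injective tuple by a repeated value leaves at most [t] choices, which drives the induction;
    for [v < t] the trivial bound avoids the truncated [v - t]. *)
Lemma expn_le_ffact (v t : nat) : (v ^ t <= v ^_ t + t ^ 2 * v ^ t.-1)%N.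
Proof.
elim: t => [|t IH]; first by rewrite ffactn0.
have [tv|vt] := leqP t v; last first.
  apply: leq_trans (leq_addl _ _); rewrite expnS leq_mul2r /=.
  apply/orP; right; apply: leq_trans (ltnW vt) _; nia.
have E : (v * v ^ t.-1 * t ^ 2 = t ^ 2 * v ^ t)%N.
  by case: (t) => [|u] //=; rewrite -expnS mulnC.
rewrite ffactnSr expnS /=.
have F : (v ^_ t * v = v ^_ t * (v - t) + v ^_ t * t)%N.
  by rewrite -mulnDr subnK.
have G : (v ^_ t <= v ^ t)%N.
  elim: (t) => [|u IHu]; first by rewrite ffactn0.
  by rewrite ffactnSr expnS mulnC leq_mul // leq_subr.
nia.
Qed.

Section SecondMoment.
Variables (R : realFieldType) (Om T : finType) (V : {set T}) (S : T -> Om -> bool).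

Let s b w : R := (S b w)%:R.

Definition tuple_on (k : nat) : {set {ffun 'I_k -> T}} :=
  [set b : {ffun 'I_k -> T} | [forall i, b i \in V]]%SET.

Lemma mem_tuple_on k (b : {ffun 'I_k -> T}) :
  (b \in tuple_on k) = (b \in ffun_on (mem V)).
Proof. by rewrite inE; apply/forallP/ffun_onP. Qed.

Lemma card_tuple_on k : #|tuple_on k| = (#|V| ^ k)%N.
Proof.
by rewrite (eq_card (@mem_tuple_on k)) card_ffun_on card_ord.
Qed.

Definition common k (b : {ffun 'I_k -> T}) : {set Om} :=
  [set w : Om | [forall i, S (b i) w]]%SET.

Lemma card_commonE k (b : {ffun 'I_k -> T}) :
  #|common b|%:R = \sum_w \prod_i s (b i) w.
Proof.
rewrite -sum1_card natr_sum (big_mkcond (fun w => w \in _)); apply: eq_bigr => w _.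
rewrite inE; case: ifPn => [/forallP H|].
  by rewrite big1 // => i _; rewrite /s H.
rewrite negb_forall => /existsP[i Hi].
by rewrite (bigD1 i) //= /s (negbTE Hi) mul0r.
Qed.

(** Double counting: the [k]-th power of the degree of [w], the number of [b] in [V] with [S b w],
    expands into a sum over [k]-tuples. *)
Lemma sum_common k :
  \sum_(b in tuple_on k) #|common b|%:R = \sum_w (\sum_(b in V) s b w) ^+ k :> R.
Proof.
under eq_bigr do rewrite card_commonE.
rewrite exchange_big /=; apply: eq_bigr => w _.
rewrite -[in RHS](card_ord k) -prodr_const bigA_distr_big.
by apply: eq_bigl => b; rewrite mem_tuple_on.
Qed.

Lemma sum_common2 k :
  \sum_(b in tuple_on k) (#|common b|%:R ^+ 2) =
  \sum_w \sum_w' (\sum_(b in V) s b w * s b w') ^+ k :> R.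
Proof.
transitivity (\sum_(b in tuple_on k) \sum_w \sum_w'
   \prod_i (s (b i) w * s (b i) w')).
  apply: eq_bigr => b _; rewrite card_commonE expr2 mulr_suml.
  apply: eq_bigr => w _; rewrite mulr_sumr; apply: eq_bigr => w' _.
  by rewrite big_split.
rewrite exchange_big /=; apply: eq_bigr => w _.
rewrite exchange_big /=; apply: eq_bigr => w' _.
rewrite -[in RHS](card_ord k) -prodr_const bigA_distr_big.
by apply: eq_bigl => b; rewrite mem_tuple_on.
Qed.

Let f w : R := \sum_(b in V) s b w.
Let g w w' : R := \sum_(b in V) s b w * s b w'.

Lemma sum_pair1 : \sum_w \sum_w' g w w' = \sum_(b in V) (#|[set w : Om | S b w]|%SET%:R) ^+ 2.
Proof.
under eq_bigr do rewrite exchange_big /=.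
rewrite exchange_big /=; apply: eq_bigr => b _.
have -> : #|[set w : Om | S b w]|%SET%:R = \sum_w s b w.
  rewrite -sum1_card natr_sum (big_mkcond (fun w => w \in _)).
  by apply: eq_bigr => w _; rewrite inE /s; case: (S b w).
rewrite expr2 mulr_suml; apply: eq_bigr => w _.
by rewrite mulr_sumr.
Qed.

(** Once the square of the codegree [g w w'] is expanded, the sums over [w] and [w'] separate, so
    each pair [b], [b'] contributes the square of an intersection size. *)
Lemma sum_pair2 : \sum_w \sum_w' g w w' ^+ 2 =
  \sum_(b in V) \sum_(b' in V) (#|[set w : Om | S b w && S b' w]|%SET%:R) ^+ 2.
Proof.
transitivity (\sum_w \sum_w' \sum_(b in V) \sum_(b' in V)
   (s b w * s b' w) * (s b w' * s b' w')).
  apply: eq_bigr => w _; apply: eq_bigr => w' _.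
  rewrite expr2 mulr_suml; apply: eq_bigr => b _.
  by rewrite mulr_sumr; apply: eq_bigr => b' _; ring.
under eq_bigr do rewrite exchange_big /=.
rewrite exchange_big /=; apply: eq_bigr => b _.
under eq_bigr do rewrite exchange_big /=.
rewrite exchange_big /=; apply: eq_bigr => b' _.
have -> : #|[set w : Om | S b w && S b' w]|%SET%:R = \sum_w s b w * s b' w.
  rewrite -sum1_card natr_sum (big_mkcond (fun w => w \in _)).
  apply: eq_bigr => w _; rewrite inE /s.
  by case: (S b w); rewrite /= ?mul0r ?mul1r //; case: (S b' w).
rewrite expr2 mulr_suml; apply: eq_bigr => w _.
by rewrite mulr_sumr.
Qed.


(** Convexity of the power function, as its tangent at [a]. The gap at exponent [n.+2] is [x] times
    the gap at [n.+1] plus a nonnegative multiple of [(x - a) ^+ 2]. *)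
Lemma exprS_tangent (a x : R) (n : nat) : 0 <= a -> 0 <= x ->
  a ^+ n.+1 + n.+1%:R * a ^+ n * (x - a) <= x ^+ n.+1.
Proof.
move=> a0 x0; elim: n => [|n IH]; first by rewrite !expr1 expr0 !mul1r; lra.
rewrite exprS -subr_ge0.
have -> : x * x ^+ n.+1 - (a ^+ n.+2 + n.+2%:R * a ^+ n.+1 * (x - a)) =
  x * (x ^+ n.+1 - (a ^+ n.+1 + n.+1%:R * a ^+ n * (x - a))) +
  n.+1%:R * a ^+ n * (x - a) ^+ 2.
  by rewrite !exprS -[n.+2%:R]natr1; ring.
rewrite addr_ge0 //; first by rewrite mulr_ge0 // subr_ge0.
apply: mulr_ge0; last exact: sqr_ge0.
by apply: mulr_ge0; [exact: ler0n | exact: exprn_ge0].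
Qed.

Variables (k : nat) (rho eps H u : R).
(** The exponent that arises from squaring [g ^+ k.-1] in the AM-GM step of [sum_gk]. *)
Let t := (2 * k.-1)%N.
Let v : R := #|V|%:R.
Let O : R := #|Om|%:R.
(** The exact mean of [g] over pairs, as [sum_g] shows. *)
Let gam := v * rho ^+ 2.

Hypothesis k_gt1 : (1 < k)%N.
Hypothesis O_gt0 : 0 < O.
Hypothesis v_gt0 : 0 < v.
Hypothesis rho_gt0 : 0 < rho.
Hypothesis eps_ge0 : 0 <= eps.
Hypothesis eps_le1 : eps <= 1.
Hypothesis H_ge1 : 1 <= H.
Hypothesis u_gt0 : 0 < u.
Hypothesis v_large : 1 <= eps * gam.
Hypothesis v_large_t : (t ^ 2)%:R <= v * rho ^+ (2 * t).
Hypothesis one_pt : forall b, b \in V -> #|[set w : Om | S b w]|%SET%:R = rho * O.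
Hypothesis two_pts : forall b b', b \in V -> b' \in V -> b != b' ->
  #|[set w : Om | S b w && S b' w]|%SET%:R <= (1 + eps) * rho ^+ 2 * O.
Hypothesis t_pts : forall b : {ffun 'I_t -> T}, b \in tuple_on t -> injective b ->
  #|common b|%:R <= H * rho ^+ t * O.

Let gam_gt0 : 0 < gam. Proof. by rewrite mulr_gt0 // exprn_gt0. Qed.

Let g_ge0 w w' : 0 <= g w w'.
Proof. by apply: sumr_ge0 => b _; rewrite mulr_ge0 // /s ler0n. Qed.

Let sum_g : \sum_w \sum_w' g w w' = O ^+ 2 * gam.
Proof.
rewrite sum_pair1; under eq_bigr do rewrite one_pt //.
by rewrite sumr_const -[LHS]mulr_natl -/v /gam; ring.
Qed.

(** Off the diagonal [two_pts] applies. A diagonal term has only [rho ^+ 2] in place of [rho ^+ 4];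
    by [v_large] this excess costs one more [eps], and [eps <= 1] linearizes [(1 + eps) ^+ 2]. *)
Let sum_g2 : \sum_w \sum_w' (g w w') ^+ 2 <= O ^+ 2 * gam ^+ 2 * (1 + 4 * eps).
Proof.
rewrite sum_pair2.
have -> : O ^+ 2 * gam ^+ 2 * (1 + 4 * eps) =
  \sum_(b in V) O ^+ 2 * v * rho ^+ 4 * (1 + 4 * eps).
  by rewrite sumr_const -[RHS]mulr_natl -/v /gam; ring.
apply: ler_sum => b bV; rewrite (bigD1 b) //=.
under eq_bigl do rewrite andbC.
have -> : #|[set w | S b w && S b w]%SET| = #|[set w | S b w]%SET|.
  by apply: eq_card => w; rewrite !inE andbb.
rewrite one_pt //.
have Hs : \sum_(i | (i != b) && (i \in V)) (#|[set w : Om | S b w && S i w]%SET|%:R) ^+ 2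
   <= \sum_(i in V) ((1 + eps) * rho ^+ 2 * O) ^+ 2.
  rewrite big_mkcondl /=; apply: ler_sum => b' b'V.
  case: ifPn => [bb'|_]; last exact: sqr_ge0.
  rewrite lerXn2r ?nnegrE ?ler0n //; last by rewrite two_pts // eq_sym.
  by rewrite !mulr_ge0 ?sqr_ge0 ?addr_ge0 ?ler01 // ltW.
apply: (le_trans (lerD (lexx _) Hs)).
rewrite sumr_const -[X in _ + X]mulr_natl -/v.
have -> : (rho * O) ^+ 2 + v * ((1 + eps) * rho ^+ 2 * O) ^+ 2 =
  O ^+ 2 * rho ^+ 2 * (1 + gam * (1 + eps) ^+ 2) by rewrite /gam; ring.
have -> : O ^+ 2 * v * rho ^+ 4 * (1 + 4 * eps) =
  O ^+ 2 * rho ^+ 2 * (gam * (1 + 4 * eps)) by rewrite /gam; ring.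
rewrite ler_pM2l ?mulr_gt0 ?exprn_gt0 //.
have : eps * eps * gam <= eps * gam by rewrite ler_pM2r // ler_piMr.
have -> : gam * (1 + eps) ^+ 2 = gam + 2 * (eps * gam) + eps * eps * gam by ring.
have -> : gam * (1 + 4 * eps) = gam + 4 * (eps * gam) by ring.
by have := v_large; lra.
Qed.

(** Variance: since the mean is exactly [gam], only the excess [4 * eps] of the second moment
    survives. *)
Let sum_dev : \sum_w \sum_w' (g w w' - gam) ^+ 2 <= 4 * eps * (O ^+ 2 * gam ^+ 2).
Proof.
have -> : \sum_w \sum_w' (g w w' - gam) ^+ 2 =
   \sum_w \sum_w' (g w w') ^+ 2 - 2 * gam * (\sum_w \sum_w' g w w') + O ^+ 2 * gam ^+ 2.
  have -> : O ^+ 2 * gam ^+ 2 = \sum_(w in Om) \sum_(w' in Om) gam ^+ 2.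
    by rewrite !sumr_const -mulrnA -[RHS]mulr_natl natrM -/O; ring.
  rewrite mulr_sumr -sumrN -!big_split; apply: eq_bigr => w _ /=.
  rewrite mulr_sumr -sumrN -!big_split; apply: eq_bigr => w' _ /=; ring.
rewrite sum_g; have := sum_g2.
have -> : O ^+ 2 * gam ^+ 2 * (1 + 4 * eps) =
  O ^+ 2 * gam ^+ 2 + 4 * eps * (O ^+ 2 * gam ^+ 2) by ring.
have -> : 2 * gam * (O ^+ 2 * gam) = 2 * (O ^+ 2 * gam ^+ 2) by ring.
lra.
Qed.

(* The few tuples with a repeated entry are bounded trivially. *)
Let sum_gt : \sum_w \sum_w' (g w w') ^+ t <= 2 * H ^+ 2 * (O ^+ 2 * gam ^+ t).
Proof.
rewrite -sum_common2.
rewrite (bigID (fun b : {ffun 'I_t -> T} => injectiveb b)) /=.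
have P1 : \sum_(b in tuple_on t | injectiveb b) (#|common b|%:R) ^+ 2 <=
    H ^+ 2 * (O ^+ 2 * gam ^+ t).
  have -> : H ^+ 2 * (O ^+ 2 * gam ^+ t) =
     \sum_(b in tuple_on t) (H * rho ^+ t * O) ^+ 2.
    rewrite sumr_const card_tuple_on -[RHS]mulr_natl natrX -/v /gam.
    by rewrite [(v * _) ^+ t]exprMn -exprM mulnC exprM; ring.
  rewrite big_mkcondr /=; apply: ler_sum => b bV.
  case: ifPn => [/injectiveP ib|_]; last exact: sqr_ge0.
  rewrite lerXn2r ?nnegrE ?ler0n ?t_pts //.
  by rewrite !mulr_ge0 ?exprn_ge0 // ?ltW // (lt_le_trans _ H_ge1) ?ltr01.
have P2 : \sum_(b in tuple_on t | ~~ injectiveb b) (#|common b|%:R) ^+ 2 <=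
    O ^+ 2 * gam ^+ t.
  have Hc : \sum_(b in tuple_on t | ~~ injectiveb b) (#|common b|%:R) ^+ 2 <=
      \sum_(b in tuple_on t | ~~ injectiveb b) O ^+ 2.
    by apply: ler_sum => b _; rewrite lerXn2r ?nnegrE ?ler0n // ler_nat max_card.
  apply: (le_trans Hc).
  rewrite sumr_const -[leLHS]mulr_natl mulrC ler_pM2l ?exprn_gt0 //.
  have Hn : (#|[pred b in tuple_on t | ~~ injectiveb b]| <= t ^ 2 * #|V| ^ t.-1)%N.
    have E1 := card_inj_ffuns_on 'I_t (mem V); rewrite card_ord in E1.
    have E2 : (#|[pred b in tuple_on t | injectiveb b]| + 
       #|[pred b in tuple_on t | ~~ injectiveb b]| = #|V| ^ t)%N.
      rewrite -card_tuple_on.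
      apply: etrans (cardID (fun b : {ffun 'I_t -> T} => injectiveb b) (tuple_on t)).
      by congr addn; apply: eq_card => b; rewrite !inE // andbC.
    have E3 : #|[pred b in tuple_on t | injectiveb b]| = (#|V| ^_ t)%N.
      rewrite -[RHS]E1; apply: eq_card => b.
      by rewrite [in RHS]inE inE mem_tuple_on.
    by have := expn_le_ffact #|V| t; rewrite -E2 E3 leq_add2l.
  apply: (le_trans (y := (t ^ 2 * #|V| ^ t.-1)%:R)).
    by rewrite ler_nat.
  have t0 : (0 < t)%N by rewrite /t; case: (k) k_gt1 => [|[|?]].
  rewrite natrM [X in _ * X]natrX -/v.
  apply: (le_trans (y := v * rho ^+ (2 * t) * v ^+ t.-1)).
    by rewrite ler_wpM2r ?exprn_ge0 // ltW.
  rewrite /gam exprMn -exprM -{3}(prednK t0) exprS; lra.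
apply: (le_trans (lerD P1 P2)).
rewrite -mulrA mulr_natl mulr2n lerD2l ler_peMl //.
  by rewrite mulr_ge0 ?exprn_ge0 // ltW.
by rewrite exprn_ege1.
Qed.

(** Convexity bounds [g ^+ k - gam ^+ k] by [k%:R * g ^+ k.-1 * (g - gam)], and AM-GM distributes
    this product between [sum_dev] and [sum_gt]; [u] is the free weight in that split. *)
Let sum_gk : \sum_w \sum_w' (g w w') ^+ k <=
  (O ^+ 2 * gam ^+ k) * (1 + k%:R * (2 * u * eps + H ^+ 2 / u)).
Proof.
(* With this normalization both error sums become multiples of [gam ^+ k], by factors of order [u]
   and [1 / u], because [t = (k - 2) + k]. *)
set y := gam ^+ (k - 2) * u.
have y0 : 0 < y by rewrite mulr_gt0 // exprn_gt0.
have kE : k = (k - 2).+2 by move: k_gt1; clear; lia.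
have pt w w' : (g w w') ^+ k <= gam ^+ k +
     k%:R / 2 * (y * (g w w' - gam) ^+ 2 + y^-1 * (g w w') ^+ t).
  (* The tangent is taken at [g w w'] and evaluated at [gam], which bounds [g ^+ k] from above. *)
  have := exprS_tangent (k - 2).+1 (g_ge0 w w') (ltW gam_gt0).
  rewrite -kE /t; have -> : ((k - 2).+1 = k.-1)%N by move: k_gt1; clear; lia.
  rewrite mulnC exprM; set x := g w w'; set h := x ^+ k.-1 => A.
  have h0 : 0 <= h by apply: exprn_ge0; apply: g_ge0.
  (* AM-GM, with y chosen to balance the L^2 deviation and the t-th moment. *)
  have B : h * (x - gam) <= (y * (x - gam) ^+ 2 + y^-1 * h ^+ 2) / 2.
    have : 0 <= y * ((x - gam) - h / y) ^+ 2 by rewrite mulr_ge0 ?sqr_ge0 // ltW.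
    have -> : y * ((x - gam) - h / y) ^+ 2 =
       y * (x - gam) ^+ 2 + y^-1 * h ^+ 2 - 2 * (h * (x - gam)).
      by field; rewrite gt_eqF.
    lra.
  have : k%:R * (h * (x - gam)) <= k%:R * ((y * (x - gam) ^+ 2 + y^-1 * h ^+ 2) / 2).
    by rewrite ler_wpM2l // ler0n.
  have -> : k%:R / 2 * (y * (x - gam) ^+ 2 + y^-1 * h ^+ 2) =
    k%:R * ((y * (x - gam) ^+ 2 + y^-1 * h ^+ 2) / 2) by field; rewrite gt_eqF.
  have : k%:R * h * (gam - x) = - (k%:R * (h * (x - gam))) by ring.
  lra.
apply: (le_trans (y := \sum_w \sum_w' (gam ^+ k +
     k%:R / 2 * (y * (g w w' - gam) ^+ 2 + y^-1 * (g w w') ^+ t)))).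
  by apply: ler_sum => w _; apply: ler_sum => w' _; apply: pt.
have -> : \sum_w \sum_w' (gam ^+ k +
     k%:R / 2 * (y * (g w w' - gam) ^+ 2 + y^-1 * (g w w') ^+ t)) =
   O ^+ 2 * gam ^+ k + k%:R / 2 * (y * (\sum_w \sum_w' (g w w' - gam) ^+ 2) +
      y^-1 * \sum_w \sum_w' (g w w') ^+ t).
  have -> : O ^+ 2 * gam ^+ k = \sum_(w in Om) \sum_(w' in Om) gam ^+ k.
    by rewrite !sumr_const -mulrnA -[RHS]mulr_natl natrM -/O; ring.
  rewrite !mulr_sumr -big_split mulr_sumr -big_split; apply: eq_bigr => w _ /=.
  by rewrite !mulr_sumr -big_split mulr_sumr -big_split.
have D1 := ler_wpM2l (ltW y0) sum_dev.
have yV : 0 <= y^-1 by rewrite invr_ge0 ltW.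
have D2 := ler_wpM2l yV sum_gt.
have E1 : y * (4 * eps * (O ^+ 2 * gam ^+ 2)) = (4 * u * eps) * (O ^+ 2 * gam ^+ k).
  have -> : gam ^+ k = gam ^+ (k - 2) * gam ^+ 2 by rewrite -exprD addn2 -kE.
  by rewrite /y; ring.
have E2 : y^-1 * (2 * H ^+ 2 * (O ^+ 2 * gam ^+ t)) = 2 * (H ^+ 2 / u) * (O ^+ 2 * gam ^+ k).
  have -> : t = (k - 2 + k)%N by rewrite /t; move: k_gt1; clear; lia.
  rewrite exprD /y; field.
  by rewrite !gt_eqF // exprn_gt0.
have := ler_wpM2l (divr_ge0 (ler0n R k) (ler0n R 2)) (lerD D1 D2).
rewrite E1 E2.
set X := O ^+ 2 * gam ^+ k; set Y := k%:R / 2 * _.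
have -> : k%:R / 2 * (4 * u * eps * X + 2 * (H ^+ 2 / u) * X) =
   k%:R * (2 * u * eps + H ^+ 2 / u) * X by field; rewrite gt_eqF.
have X0 : 0 <= X by rewrite mulr_ge0 ?exprn_ge0 // ltW.
have -> : X * (1 + k%:R * (2 * u * eps + H ^+ 2 / u)) =
  X + k%:R * (2 * u * eps + H ^+ 2 / u) * X by ring.
rewrite /Y; lra.
Qed.

(** Chebyshev's inequality: a tuple without common element contributes the full
    [(O * rho ^+ k) ^+ 2] to the sum of squared deviations of [#|common b|] from [O * rho ^+ k].
    That sum needs a lower bound for the first moment and the upper bound [sum_gk] for the
    second. *)
Lemma few_uncommon :
  #|[set b in tuple_on k | #|common b| == 0%N]%SET|%:R <=
  k%:R * (2 * u * eps + H ^+ 2 / u) * v ^+ k.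
Proof.
set bad := [set b in tuple_on k | _]%SET.
set Y := k%:R * _.
have Z0 : 0 < O ^+ 2 * rho ^+ (2 * k) by rewrite mulr_gt0 ?exprn_gt0.
rewrite -(ler_pM2r Z0).
(* Jensen: the degrees [f w] have mean [v * rho], so the linear terms of the tangents at the mean
   sum to zero. *)
have first : O * (v * rho) ^+ k <= \sum_(b in tuple_on k) #|common b|%:R.
  rewrite sum_common.
  have Sf : \sum_w f w = O * (v * rho).
    rewrite exchange_big /=.
    transitivity (\sum_(b in V) (rho * O)); last first.
      by rewrite sumr_const -[LHS]mulr_natl -/v; ring.
    apply: eq_bigr => b bV; rewrite -(one_pt bV).
    rewrite -sum1_card natr_sum (big_mkcond (fun w => w \in _)).
    by apply: eq_bigr => w _; rewrite inE /s; case: (S b w).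
  have -> : O * (v * rho) ^+ k = \sum_w ((v * rho) ^+ k +
        k%:R * (v * rho) ^+ k.-1 * (f w - v * rho)).
    rewrite big_split /= -mulr_sumr sumrB Sf.
    have cst (x : R) : \sum_(w : Om) x = O * x by rewrite sumr_const -mulr_natl.
    by rewrite !cst subrr mulr0 addr0.
  apply: ler_sum => w _.
  have k0 : k = k.-1.+1 by move: k_gt1; clear; lia.
  rewrite {1 2 4}k0; apply: exprS_tangent; first by rewrite mulr_ge0 // ltW.
  by apply: sumr_ge0 => b _; rewrite ler0n.
have second : \sum_(b in tuple_on k) (#|common b|%:R ^+ 2) <= 
  (O ^+ 2 * gam ^+ k) * (1 + Y).
  by rewrite sum_common2; apply: sum_gk.
have key : #|bad|%:R * (O ^+ 2 * rho ^+ (2 * k)) <=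
    \sum_(b in tuple_on k) (#|common b|%:R - O * rho ^+ k) ^+ 2.
  rewrite mulr_natl -sumr_const.
  rewrite [leRHS](bigID (fun b => b \in bad)) /= -[leLHS]addr0 lerD //; last first.
    by apply: sumr_ge0 => b _; apply: sqr_ge0.
  rewrite le_eqVlt; apply/orP; left; apply/eqP; apply: eq_big => b.
    by rewrite !inE; case: [forall i, _].
  rewrite inE => /andP[_ /eqP->]; rewrite mulnC exprM; ring.
apply: (le_trans key).
have -> : \sum_(b in tuple_on k) (#|common b|%:R - O * rho ^+ k) ^+ 2 =
  \sum_(b in tuple_on k) (#|common b|%:R ^+ 2) - 
   2 * (O * rho ^+ k) * (\sum_(b in tuple_on k) #|common b|%:R) +
   v ^+ k * (O * rho ^+ k) ^+ 2.
  have -> : v ^+ k * (O * rho ^+ k) ^+ 2 = \sum_(b in tuple_on k) (O * rho ^+ k) ^+ 2.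
    by rewrite sumr_const card_tuple_on -[RHS]mulr_natl natrX.
  rewrite mulr_sumr -sumrN -!big_split; apply: eq_bigr => b _ /=; ring.
have Q0 : 0 <= 2 * (O * rho ^+ k) by rewrite !mulr_ge0 ?exprn_ge0 // ltW.
have := ler_wpM2l Q0 first.
have -> : 2 * (O * rho ^+ k) * (O * (v * rho) ^+ k) = 2 * (O ^+ 2 * gam ^+ k).
  by rewrite /gam !exprMn; ring.
have -> : v ^+ k * (O * rho ^+ k) ^+ 2 = O ^+ 2 * gam ^+ k.
  by rewrite /gam !exprMn; ring.
have -> : Y * v ^+ k * (O ^+ 2 * rho ^+ (2 * k)) = O ^+ 2 * gam ^+ k * Y.
  by rewrite /gam !exprMn mulnC exprM; ring.
move: second; rewrite mulrDr mulr1; lra.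
Qed.

End SecondMoment.

(** * Brun's pure sieve *)

Lemma count_residue_class (X d r : nat) : (r < d)%N ->
  (X %/ d <= \sum_(x < X) (x %% d == r) <= (X %/ d).+1)%N.
Proof.
move=> rd; have d0 : (0 < d)%N by apply: leq_ltn_trans rd.
have blocks Q : (\sum_(0 <= x < Q * d) (x %% d == r) = Q)%N.
  elim: Q => [|Q IH]; first by rewrite mul0n big_geq.
  rewrite (big_cat_nat (n := (Q * d)%N)) //=; last by rewrite leq_mul2r leqnSn orbT.
  rewrite IH mulSn -{1}[(Q * d)%N]add0n big_addn addnK.
  under eq_bigr do rewrite addnC modnMDl.
  rewrite big_mkord (bigD1 (Ordinal rd)) //= modn_small // eqxx.
  rewrite big1 ?addn0 ?addn1 // => i; rewrite -val_eqE /= modn_small //.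
  by case: eqP.
rewrite -(big_mkord predT (fun x => ((x %% d == r)%N : nat))).
apply/andP; split.
  rewrite -{1}(blocks (X %/ d)%N) [leqRHS](big_cat_nat (n := (X %/ d * d)%N)) ?leq_trunc_div //=.
  exact: leq_addr.
rewrite -[leqRHS](blocks (X %/ d)%N.+1) [leqRHS](big_cat_nat (n := X)) //=.
  exact: leq_addr.
by apply: ltnW; rewrite ltn_ceil.
Qed.

Section BrunSieve.
Variables (R : realFieldType) (X t : nat) (hit : nat -> nat -> bool).

(** The residue class modulo [d] is carried along because removing the multiples of one more prime
    passes to classes modulo a product. *)
Definition sifted (P : seq nat) (c d : nat) : nat :=
  (\sum_(x < X | (x == c %[mod d]) && all (fun q => ~~ hit q x) P) 1)%N.

Definition sievable (q : nat) : Prop :=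
  [/\ prime q, forall x, hit q x = hit q (x %% q)%N &
      (\sum_(r < q | hit q r) 1 = t)%N].

(** Buchstab's identity: the integers hit by [q] are split by their residue modulo [q], and the
    Chinese remainder theorem merges that residue with the class of [c] modulo [d]. *)
Lemma sifted_cons q P c d : sievable q -> coprime d q ->
  (sifted P c d = sifted (q :: P) c d +
     \sum_(r < q | hit q r) sifted P (chinese d q c r) (d * q))%N.
Proof.
move=> [pq hitP _] cdq; rewrite /sifted.
have q0 := prime_gt0 pq.
rewrite (bigID (fun x : 'I_X => hit q x)) /= addnC; congr addn.
  by apply: eq_bigl => x; rewrite -andbA [all _ _ && _]andbC.
rewrite (partition_big (fun x : 'I_X => Ordinal (ltn_pmod x q0))
    (fun r : 'I_q => hit q r)) /=; last first.
  by move=> x /andP[_]; rewrite hitP.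
apply: eq_bigr => r hr; apply: eq_bigl => x.
rewrite chinese_remainder // chinese_modl // chinese_modr //.
rewrite -val_eqE /= [(r %% q)%N]modn_small // -!andbA; congr andb.
rewrite [RHS]andbC; case: all => //=.
by case: eqP => [E|]; rewrite ?andbF // hitP E hr.
Qed.

Let g (q : nat) : R := t%:R / q%:R.

(* Inclusion-exclusion truncated below s prime factors, peeled off one prime at
   a time: an upper bound for odd s, a lower bound for even s. *)
Fixpoint brun_main (s : nat) (P : seq nat) : R :=
  match s, P with
  | 0, _ => 0
  | _.+1, [::] => 1
  | s'.+1, q :: P' => brun_main s P' - g q * brun_main s' P'
  end.

(** The number of residue classes counted in the truncated inclusion-exclusion; each costs a
    rounding error of at most 1. *)
Fixpoint brun_err (s : nat) (P : seq nat) : nat :=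
  match s, P with
  | 0, _ => 0
  | _.+1, [::] => 1
  | s'.+1, q :: P' => brun_err s P' + t * brun_err s' P'
  end%N.

(** Induction on [P] through [sifted_cons]. The subtracted sum is bounded in the opposite direction
    at depth one less, so both parities are treated together and for every class. *)
Lemma brun_sifted P : {in P, forall q, sievable q} -> uniq P ->
  forall s c d, (0 < d)%N -> all (coprime d) P ->
  (odd s -> (sifted P c d)%:R <= X%:R / d%:R * brun_main s P + (brun_err s P)%:R) /\
  (~~ odd s -> X%:R / d%:R * brun_main s P - (brun_err s P)%:R <= (sifted P c d)%:R).
Proof.
elim: P => [|q P IH] siev uP [|s] c d d0 cop.
- by split => // _; rewrite mulr0 subrr ler0n.
- rewrite /= mulr1.
  have d0' : 0 < d%:R :> R by rewrite ltr0n.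
  have /andP[l1 l2] := count_residue_class X (ltn_pmod c d0).
  have -> : sifted [::] c d = (\sum_(x < X) (x %% d == c %% d))%N.
    by rewrite /sifted big_mkcond /=; apply: eq_bigr => x _; rewrite andbT; case: eqP.
  split=> _.
    apply: (le_trans (y := (X %/ d)%N.+1%:R)); first by rewrite ler_nat.
    rewrite -natr1 lerD2r ler_pdivlMr // -natrM ler_nat; exact: leq_trunc_div.
  apply: (le_trans (y := (X %/ d)%N%:R)); last by rewrite ler_nat.
  rewrite lerBlDr ler_pdivrMr // natr1 -natrM ler_nat; apply: ltnW.
  exact: ltn_ceil.
- by split => // _; rewrite mulr0 subrr ler0n.
have sq : sievable q by apply: siev; rewrite mem_head.
have sP : {in P, forall q, sievable q} by move=> p pP; apply: siev; rewrite inE pP orbT.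
move: uP cop => /= /andP[qP uP] /andP[cdq cop].
have [pq _ ht] := sq; have q0 := prime_gt0 pq.
have q0' : 0 < q%:R :> R by rewrite ltr0n.
have d0' : 0 < d%:R :> R by rewrite ltr0n.
have E := sifted_cons P c sq cdq.
have {IH} IH := IH sP uP.
have [I1 I2] := IH s.+1 c d d0 cop.
have copq : all (coprime (d * q)) P.
  apply/allP => p pP; rewrite coprimeMl (allP cop) //=.
  rewrite prime_coprime //; have [pp _ _] := sP p pP.
  rewrite dvdn_prime2 //; apply: contra qP => /eqP->//.
have dq0 : (0 < d * q)%N by rewrite muln_gt0 d0.
have J (r : 'I_q) := IH s (chinese d q c r) (d * q)%N dq0 copq.
have E' : (sifted (q :: P) c d)%:R = (sifted P c d)%:R -
    \sum_(r < q | hit q r) (sifted P (chinese d q c r) (d * q))%:R :> R.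
  by rewrite -natr_sum E natrD addrK.
have sumc (y : R) : \sum_(r < q | hit q r) y = t%:R * y.
  by rewrite -ht natr_sum mulr_suml; apply: eq_bigr => r _; rewrite mul1r.
rewrite /= !negbK; split => os.
  have H2 : \sum_(r < q | hit q r) (X%:R / (d * q)%:R * brun_main s P - (brun_err s P)%:R)
     <= \sum_(r < q | hit q r) (sifted P (chinese d q c r) (d * q))%:R.
    by apply: ler_sum => r _; have [_ ] := J r; apply.
  have H1 := I1 os.
  rewrite sumc in H2; rewrite E' natrD natrM.
  apply: (le_trans (lerB H1 H2)).
  rewrite le_eqVlt; apply/orP; left; apply/eqP; rewrite natrM /g; field.
  by rewrite !gt_eqF.
have H2 : \sum_(r < q | hit q r) (sifted P (chinese d q c r) (d * q))%:R <=
   \sum_(r < q | hit q r) (X%:R / (d * q)%:R * brun_main s P + (brun_err s P)%:R).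
  by apply: ler_sum => r _; have [+ _] := J r; apply.
move: (I2); rewrite [~~ odd _]negbK => /(_ os) H1.
rewrite sumc in H2; rewrite E' natrD natrM.
apply: le_trans (lerB H1 H2).
rewrite le_eqVlt; apply/orP; left; apply/eqP; rewrite natrM /g; field.
by rewrite !gt_eqF.
Qed.

Lemma brun_err_le s P : (brun_err s P <= (1 + t * size P) ^ s)%N.
Proof.
elim: P s => [|q P IH] [|s] //=; first by rewrite muln0 addn0 exp1n.
have I1 := IH s.+1; have I2 := IH s.
apply: leq_trans (leq_add I1 (leq_mul (leqnn t) I2)) _.
have h : ((1 + t * size P) ^ s <= (1 + t * (size P).+1) ^ s)%N.
  case: (s) => [|s0] //; by rewrite leq_exp2r // leq_add2l leq_mul2l leqnSn orbT.
rewrite expnS -mulnDl expnS; apply: leq_mul => //.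
by rewrite mulnSr addnA.
Qed.

(** The elementary symmetric polynomial of degree [s] in the values [g q]. *)
Fixpoint elem_sym (s : nat) (P : seq nat) : R :=
  match s, P with
  | 0, _ => 1
  | _.+1, [::] => 0
  | s'.+1, q :: P' => elem_sym s P' + g q * elem_sym s' P'
  end.

(** Rankin's trick: the left side is one term of the expansion of the right side in powers of [u],
    all of whose coefficients are nonnegative. *)
Lemma elem_sym_le s P (u : R) : 0 <= u ->
  elem_sym s P * u ^+ s <= \prod_(q <- P) (1 + u * g q).
Proof.
move=> u0; elim: P s => [|q P IH] [|s] /=.
- by rewrite big_nil mulr1.
- by rewrite big_nil mul0r.
- rewrite mulr1; elim/big_rec: _ => // i x _ x1.
  by rewrite mulr_ege1 // lerDl mulr_ge0 // divr_ge0 ?ler0n.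
rewrite big_cons mulrDl mulrDl mul1r lerD //.
rewrite exprS.
have -> : g q * elem_sym s P * (u * u ^+ s) = u * g q * (elem_sym s P * u ^+ s) by ring.
by rewrite ler_wpM2l // mulr_ge0 // divr_ge0 ?ler0n.
Qed.

(** A Bonferroni bound: by the triangle inequality the truncation error obeys the recursion that
    defines [elem_sym]. The condition [t <= q] keeps the full product in the unit interval, which
    settles depth 0. *)
Lemma brun_main_prod s P : all (fun q => (t <= q)%N && (0 < q)%N) P ->
  `|brun_main s P - \prod_(q <- P) (1 - g q)| <= elem_sym s P.
Proof.
elim: P s => [|q P IH] [|s] /= H.
- by rewrite big_nil sub0r normrN1.
- by rewrite big_nil subrr normr0.
- rewrite sub0r normrN.
  have B : forall p, p \in q :: P -> 0 <= 1 - g p <= 1.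
    move=> p pP.
    have /allP/(_ p pP)/andP[tp p0] :
      all (fun q => (t <= q)%N && (0 < q)%N) (q :: P) by [].
    rewrite subr_ge0 gerBl divr_ge0 ?ler0n // andbT.
    by rewrite ler_pdivrMr ?ltr0n // mul1r ler_nat.
  have /andP[P0 P1] : 0 <= \prod_(p <- q :: P) (1 - g p) <= 1.
    rewrite big_seq; elim/big_rec: _ => [|p x /B/andP[b0 b1] /andP[x0 x1]].
      by rewrite ler01 lexx.
    by rewrite mulr_ge0 //= mulr_ile1.
  by rewrite ger0_norm.
move: H => /andP[_ H]; rewrite big_cons.
have -> : brun_main s.+1 P - g q * brun_main s P - (1 - g q) * \prod_(j <- P) (1 - g j)
 = (brun_main s.+1 P - \prod_(j <- P) (1 - g j)) -
   g q * (brun_main s P - \prod_(j <- P) (1 - g j)) by ring.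
apply: (le_trans (ler_normB _ _)); rewrite lerD ?IH //.
have gq : 0 <= g q by rewrite divr_ge0 ?ler0n.
by rewrite normrM (ger0_norm gq) ler_wpM2l // IH.
Qed.

Lemma brun_sieve s P : odd s -> {in P, forall q, sievable q} -> uniq P ->
  (\sum_(x < X | all (fun q => ~~ hit q x) P) 1)%:R <=
  X%:R * (\prod_(q <- P) (1 - t%:R / q%:R) +
     (\prod_(q <- P) (1 + 4 * (t%:R / q%:R))) / 4 ^+ s) + ((1 + t * size P) ^ s)%:R :> R.
Proof.
move=> os sP uP.
have cop : all (coprime 1) P by apply/allP => q _; rewrite coprime1n.
have [H _] := brun_sifted sP uP s 0 (ltn0Sn 0) cop.
have -> : (\sum_(x < X | all (fun q => ~~ hit q x) P) 1)%N = sifted P 0 1.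
  by apply: eq_bigl => x; rewrite !modn1 eqxx.
apply: (le_trans (H os)); rewrite divr1 lerD ?ler_nat ?brun_err_le // ler_wpM2l ?ler0n //.
have tq : all (fun q => (t <= q)%N && (0 < q)%N) P.
  apply/allP => q /sP[pq _ <-]; rewrite prime_gt0 // andbT.
  apply: leq_trans (_ : (\sum_(r < q) 1 <= q)%N); last by rewrite sum1_card card_ord.
  by rewrite [leqLHS]big_mkcond; apply: leq_sum => r _; case: ifP.
have := brun_main_prod s tq; rewrite ler_norml => /andP[_].
(* The weight 4 makes the truncation error decay like [4 ^- s]. *)
have := @elem_sym_le s P 4 (ler0n _ 4).
rewrite -ler_pdivlMr ?exprn_gt0 // => A B.
by rewrite -lerBlDl; apply: le_trans B A.
Qed.

End BrunSieve.

(** * Estimates for primes *)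

Definition primes_le (n : nat) : seq nat := [seq p <- iota 0 n.+1 | prime p].

Lemma mem_primes_le n p : (p \in primes_le n) = prime p && (p <= n)%N.
Proof. by rewrite mem_filter mem_iota. Qed.

Lemma primes_le_uniq n : uniq (primes_le n).
Proof. by rewrite filter_uniq // iota_uniq. Qed.

Lemma primes_le_cat m n : (m <= n)%N ->
  primes_le n = primes_le m ++ [seq p <- primes_le n | (m < p)%N].
Proof.
move=> mn; have E : primes_le n =
    primes_le m ++ [seq p <- iota m.+1 (n - m) | prime p].
  by rewrite /primes_le -filter_cat -{1}(subnKC mn) -addSn iotaD add0n.
rewrite {1}E; congr cat; rewrite E filter_cat.
rewrite [X in X ++ _](_ : _ = [::]) /=; last first.
  apply/eqP; rewrite -size_eq0 size_filter -leqn0 leqNgt -has_count.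
  by apply/hasPn => p; rewrite mem_primes_le -leqNgt => /andP[].
symmetry; apply/all_filterP/allP => p; rewrite mem_filter mem_iota.
by case/and3P.
Qed.

Lemma prod_primes_dvd (s : seq nat) (m : nat) : uniq s -> all prime s ->
  {in s, forall p, p %| m}%N -> (\prod_(p <- s) p %| m)%N.
Proof.
elim: s => [|p s IH] /=; first by rewrite big_nil.
move=> /andP[ps us] /andP[pp as_] H; rewrite big_cons Gauss_dvd.
  rewrite H ?mem_head //= IH // => q qs; apply: H; by rewrite inE qs orbT.
rewrite prime_coprime // Euclid_dvd_prod //.
apply/negP; rewrite big_has => /hasP[q qs].
by rewrite dvdn_prime2 ?(allP as_ q qs) // => /eqP E; move: ps; rewrite E qs.
Qed.

Lemma prime_dvd_fact p n : prime p -> (p %| n`!)%N -> (p <= n)%N.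
Proof.
move=> pp; elim: n => [|n IH]; first by rewrite dvdn1 => /eqP E; rewrite E in pp.
rewrite factS Euclid_dvdM // => /orP[/dvdn_leq->//|/IH h].
exact: leqW.
Qed.

Lemma central_bin_fact n : ('C(2 * n, n) * (n`! * n`!) = (2 * n)`!)%N.
Proof.
by rewrite -(@bin_fact (2 * n) n) ?leq_pmull // mul2n -addnn addnK.
Qed.

Lemma central_bin_le n : ('C(2 * n, n) <= 4 ^ n)%N.
Proof.
have -> : (4 ^ n = \sum_(i < (2 * n).+1) 'C(2 * n, i))%N.
  rewrite -[4%N]/(2 ^ 2)%N -expnM -[2%N in LHS]/(1 + 1)%N expnDn.
  by apply: eq_bigr => i _; rewrite !exp1n !muln1.
have ln : (n < (2 * n).+1)%N by rewrite ltnS leq_pmull.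
by rewrite (bigD1 (Ordinal ln)) //= leq_addr.
Qed.

Lemma central_bin_ge n : (2 ^ n <= 'C(2 * n, n))%N.
Proof.
elim: n => [|n IH]; first by rewrite bin0.
have -> : (2 * n.+1 = (2 * n).+2)%N by lia.
rewrite binS [('C((2 * n).+1, n.+1))]binS expnS.
have H : ('C(2 * n, n) <= 'C((2 * n).+1, n))%N.
  by case: (n) => [|m]; rewrite ?bin0 // [leqRHS]binS leq_addr.
by move: IH H; move: (2 ^ n)%N 'C(2 * n, n) 'C(_, _) 'C(_, _); lia.
Qed.

(** Chebyshev's upper bound: the primes between [2 ^ j] and [2 ^ j.+1] all divide a central binomial
    coefficient, which is at most [4 ^ (2 ^ j)], and each of them exceeds [2 ^ j]. *)
Lemma size_primes_dyadic j :
  (j * size [seq p <- primes_le (2 ^ j.+1) | (2 ^ j < p)%N] <= 2 ^ j.+1)%N.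
Proof.
set s := [seq _ <- _ | _].
have us : uniq s by rewrite filter_uniq ?primes_le_uniq.
have sP p : p \in s -> [/\ prime p, (2 ^ j < p)%N & (p <= 2 ^ j.+1)%N].
  by rewrite mem_filter mem_primes_le => /and3P[].
have as_ : all prime s by apply/allP => p /sP[].
have D : (\prod_(p <- s) p %| 'C(2 * 2 ^ j, 2 ^ j))%N.
  apply: prod_primes_dvd => // p /sP[pp lp up].
  have : (p %| (2 * 2 ^ j)`!)%N by rewrite dvdn_fact // prime_gt0 // -expnS.
  rewrite -central_bin_fact Euclid_dvdM // => /orP[//|].
  by rewrite Euclid_dvdM // orbb => /prime_dvd_fact-/(_ pp); rewrite leqNgt lp.
have C0 : (0 < 'C(2 * 2 ^ j, 2 ^ j))%N by rewrite bin_gt0 leq_pmull.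
have := leq_trans (dvdn_leq C0 D) (central_bin_le _).
have -> : (4 ^ (2 ^ j) = 2 ^ (2 ^ j.+1))%N by rewrite -[4%N]/(2 ^ 2)%N -expnM -expnS.
move=> U.
rewrite -(@leq_exp2l 2) // expnM; apply: leq_trans U.
elim: (s) sP => [|p r IH] sP; first by rewrite big_nil.
rewrite big_cons /= expnS leq_mul //; first by have [] := sP p (mem_head _ _) => _ /ltnW.
by apply: IH => q qr; apply: sP; rewrite inE qr orbT.
Qed.

(* Every prime power dividing the central binomial coefficient is at most 2 n. *)
Lemma central_bin_primes n : (0 < n)%N ->
  (2 ^ n <= (2 * n) ^ size (primes_le (2 * n)))%N.
Proof.
move=> n0; apply: leq_trans (central_bin_ge n) _.
have C0 : (0 < 'C(2 * n, n))%N by rewrite bin_gt0 leq_pmull.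
have n20 : (0 < 2 * n)%N by lia.
rewrite [leqLHS](prod_prime_decomp C0) prime_decompE big_map /=.
have prim p : p \in primes 'C(2 * n, n) -> prime p && (p <= 2 * n)%N.
  rewrite mem_primes => /and3P[pp _ pC]; rewrite pp /=.
  apply: (prime_dvd_fact pp); rewrite -central_bin_fact; exact: dvdn_mulr.
apply: (@leq_trans (\prod_(p <- primes 'C(2 * n, n)) (2 * n))%N).
  rewrite !big_seq; apply: leq_prod => p /prim/andP[pp p2n].
  have p1 := prime_gt1 pp.
  (* Legendre's formula. Each summand is 0 or 1 and vanishes once [p ^ k] exceeds [2 * n], so the
     exponent is at most [trunc_log p (2 * n)]. *)
  have -> : logn p 'C(2 * n, n) = (\sum_(1 <= k < (2 * n).+1) (2 * n %/ p ^ k - 2 * (n %/ p ^ k)))%N.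
    have L : logn p (2 * n)`! = (logn p 'C(2 * n, n) + 2 * logn p n`!)%N.
      by rewrite -central_bin_fact !lognM ?muln_gt0 ?fact_gt0 //; lia.
    rewrite -[LHS](addnK (2 * logn p n`!)) -L !logn_fact //.
    have -> : (\sum_(1 <= k < n.+1) n %/ p ^ k = \sum_(1 <= k < (2 * n).+1) n %/ p ^ k)%N.
      rewrite [RHS](big_cat_nat (n := n.+1)) //=; last by lia.
      rewrite [X in (_ + X)%N]big1_seq ?addn0 // => k; rewrite mem_index_iota => /andP[_ /andP[nk _]].
      by apply: divn_small; apply: leq_trans nk _; apply: ltnW; apply: ltn_expl.
    rewrite big_distrr /= -sumnB // => k _.
    by rewrite leq_divRL ?expn_gt0 ?prime_gt0 // -mulnA leq_mul2l leq_trunc_div.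
  set e := trunc_log p (2 * n).
  have : (\sum_(1 <= k < (2 * n).+1) (2 * n %/ p ^ k - 2 * (n %/ p ^ k)) <= e)%N.
    have -> : e = (\sum_(1 <= k < (2 * n).+1 | (k <= e)%N) 1)%N.
      have e2n : (e <= 2 * n)%N.
        have h := trunc_logP p1 n20; apply: leq_trans h; apply: ltnW; exact: ltn_expl.
      rewrite (big_cat_nat (n := e.+1)) //= [X in (_ + X)%N]big1_seq; last first.
        by move=> k; rewrite mem_index_iota => /and3P[ke ek _]; rewrite leqNgt ek in ke.
      rewrite addn0 big_seq_cond (eq_bigl (fun k => k \in index_iota 1 e.+1)); last first.
        move=> k; rewrite mem_index_iota ltnS; case: (k <= e)%N; rewrite ?andbT ?andbF //.
      by rewrite -big_seq sum_nat_const_nat muln1 subn1.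
    rewrite [leqRHS]big_mkcond /=; apply: leq_sum => k _.
    case: (leqP k e) => ke; last first.
      rewrite divn_small //; apply: leq_trans (trunc_log_ltn _ p1) _.
      by rewrite leq_exp2l.
    have pk : (0 < p ^ k)%N by rewrite expn_gt0 prime_gt0.
    rewrite leq_subLR -ltnS ltn_divLR //.
    have := ltn_ceil n pk; nia.
  move=> le; apply: leq_trans (trunc_logP p1 n20).
  by rewrite leq_exp2l.
have -> r : (\prod_(p <- r) (2 * n) = (2 * n) ^ size r)%N.
  by elim: r => [|p r IH]; rewrite ?big_nil // big_cons IH expnS.
rewrite leq_pexp2l // uniq_leq_size ?primes_uniq // => p /prim.
by rewrite mem_primes_le.
Qed.

(** * Reciprocal sums over primes and Mertens' product *)

Section PrimeSums.
Variable R : realType.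

Definition prime_recip (Z : nat) : R := \sum_(q <- primes_le Z) q%:R^-1.

Lemma prime_recip_mono m n : (m <= n)%N -> prime_recip m <= prime_recip n.
Proof.
move=> mn; rewrite /prime_recip (primes_le_cat mn) big_cat /= lerDl.
by apply: sumr_ge0 => q _; rewrite invr_ge0 ler0n.
Qed.

(** The dyadic block above [2 ^ j] has at most [2 ^ j.+1 / j] primes, each with reciprocal at most
    [2 ^- j]; the term [2^-1] is the prime 2. *)
Lemma prime_recip_dyadic J :
  prime_recip (2 ^ J.+1) <= 2^-1 + \sum_(1 <= j < J.+1) 2 / j%:R.
Proof.
elim: J => [|J IH].
  by rewrite big_geq // addr0 /prime_recip /primes_le /= big_seq1.
have le2 : (2 ^ J.+1 <= 2 ^ J.+2)%N by rewrite leq_exp2l.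
rewrite /prime_recip (primes_le_cat le2) big_cat /= big_nat_recr //= addrA.
apply: lerD => //.
set s := [seq _ <- _ | _].
have p2 : 0 < (2 ^ J.+1)%:R :> R by rewrite ltr0n expn_gt0.
apply: (le_trans (y := \sum_(q <- s) (2 ^ J.+1)%:R^-1)).
  rewrite big_seq [leRHS]big_seq; apply: ler_sum => q; rewrite mem_filter => /andP[lq _].
  rewrite lef_pV2 ?posrE // ?ler_nat; first exact: ltnW.
  by rewrite ltr0n; apply: leq_ltn_trans lq.
rewrite big_const_seq count_predT iter_addr_0 -[_ *+ _]mulr_natl.
rewrite ler_pdivrMr // mulrAC ler_pdivlMr ?ltr0Sn // -!natrM ler_nat mulnC.
by rewrite -expnS; exact: size_primes_dyadic.
Qed.

Lemma harmonic_le n : (0 < n)%N -> \sum_(1 <= j < n.+1) j%:R^-1 <= 1 + ln n%:R :> R.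
Proof.
elim: n => // n IH _; case: n IH => [_|n IH].
  by rewrite big_nat1 ln1 addr0 invr1.
rewrite big_nat_recr //=.
have n1 : 0 < n.+1%:R :> R by rewrite ltr0Sn.
have n2 : 0 < n.+2%:R :> R by rewrite ltr0Sn.
have step : n.+2%:R^-1 <= ln n.+2%:R - ln n.+1%:R :> R.
  have E : n.+1%:R = n.+2%:R * (1 + - n.+2%:R^-1) :> R.
    by rewrite mulrBr mulr1 mulfV ?pnatr_eq0 // -[n.+2%:R]natr1 addrK.
  have p : 0 < 1 + - n.+2%:R^-1 :> R.
    by rewrite subr_gt0 invf_lt1 // ltr1n.
  rewrite E lnM ?posrE // opprD addNKr.
  rewrite lerNr; apply: le_ln1Dx; by rewrite -subr_gt0 opprK addrC.
by apply: (le_trans (lerD (IH isT) step)); rewrite -addrA [ln n.+1%:R + _]addrC subrK.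
Qed.

Lemma harmonic_ge n : ln n.+1%:R <= \sum_(1 <= j < n.+1) j%:R^-1 :> R.
Proof.
elim: n => [|n IH]; first by rewrite big_geq // ln1.
rewrite big_nat_recr //=.
have n1 : 0 < n.+1%:R :> R by rewrite ltr0Sn.
have E : n.+2%:R = n.+1%:R * (1 + n.+1%:R^-1) :> R.
  by rewrite mulrDr mulr1 mulfV ?pnatr_eq0 // natr1.
have i0 : 0 < n.+1%:R^-1 :> R by rewrite invr_gt0.
rewrite E lnM ?posrE ?addr_gt0 // lerD // le_ln1Dx //.
by apply: lt_trans i0; rewrite oppr_lt0.
Qed.

(** The upper bound in Mertens' second theorem; [J] plays the role of [log Z], so the bound is of
    order [log log Z]. *)
Lemma prime_recip_le Z J : (0 < J)%N -> (Z <= 2 ^ J.+1)%N ->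
  prime_recip Z <= 3 + 2 * ln J%:R.
Proof.
move=> J0 ZJ; apply: (le_trans (prime_recip_mono ZJ)).
apply: (le_trans (prime_recip_dyadic J)).
rewrite -mulr_sumr; have := harmonic_le J0; lra.
Qed.

Definition smooth (ps : seq nat) (n : nat) : bool := all (mem ps) (primes n).

(* Splitting the new sum according to divisibility by q gives h' <= h + h' / q,
   so unique factorization is not needed. *)
Lemma euler_product_ge Z ps : uniq ps -> all prime ps ->
  (\prod_(q <- ps) (1 - q%:R^-1)) *
    (\sum_(1 <= n < Z.+1 | smooth ps n) n%:R^-1) <= 1 :> R.
Proof.
elim: ps => [|q ps IH] /=.
  move=> _ _; rewrite big_nil mul1r.
  have sm1 n : (0 < n)%N -> smooth [::] n -> n = 1%N.
    rewrite /smooth; case: n => [//|[//|n]] _ /allP H.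
    by have := H (pdiv n.+2); rewrite mem_primes pdiv_prime //= pdiv_dvd => /(_ isT).
  case: Z => [|Z]; first by rewrite big_geq.
  rewrite big_mkcond big_ltn //= invr1 [X in _ + X]big1_seq ?addr0 //.
  move=> n; rewrite mem_index_iota => /andP[_ /andP[n1 _]].
  by case: ifP => // sn; move: (n1); rewrite (sm1 n (ltnW n1) sn).
move=> /andP[qps ups] /andP[pq aps].
have {IH} := IH ups aps.
rewrite big_cons.
set P := \prod_(_ <- _) _.
set h := \sum_(_ <= _ < _ | smooth ps _) _; set h' := \sum_(_ <= _ < _ | _) _.
move=> IH.
have q0 : 0 < q%:R :> R by rewrite ltr0n prime_gt0.
have P0 : 0 <= P.
  rewrite /P big_seq; apply: prodr_ge0 => p pps; rewrite subr_ge0.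
  rewrite invf_le1 ?ler1n ?ltr0n prime_gt0 //; exact: (allP aps).
suff E : h' <= h + q%:R^-1 * h'.
  rewrite -mulrA mulrCA; apply: le_trans IH; rewrite ler_wpM2l //.
  by rewrite mulrBl mul1r lerBlDr.
rewrite {1}/h' (bigID (fun n => q %| n)%N) /= addrC; apply: lerD.
  rewrite /h big_mkcond [leRHS]big_mkcond /= big_seq [leRHS]big_seq; apply: ler_sum => n.
  rewrite mem_index_iota => /andP[n0 _].
  case: ifPn => [/andP[sn qn]|_]; last by case: ifP => _ //; rewrite invr_ge0 ler0n.
  rewrite ifT //; apply/allP => p pn; have := allP sn p pn; rewrite inE.
  case/orP => // /eqP E; rewrite E in pn.
  by move: pn qn; rewrite mem_primes => /and3P[_ _ ->].
rewrite mulr_sumr.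
(* Reindexing of the multiples of [q] by their quotient: [F n'] has at most one term, the one with
   [n = q * n']. *)
pose F n' : R := \sum_(1 <= n < Z.+1 | (smooth (q :: ps) n && (q %| n)%N) && (n == q * n')%N)
   q%:R^-1 * n'%:R^-1.
apply: (le_trans (y := \sum_(1 <= n' < Z.+1) F n')).
  rewrite /F (exchange_big_dep (fun n => smooth (q :: ps) n && (q %| n)%N)) /=; last first.
    by move=> i j _ /andP[].
  rewrite big_seq_cond [leRHS]big_seq_cond; apply: ler_sum => n /andP[].
  rewrite mem_index_iota => /andP[n0 nZ] /andP[sn qn]; rewrite sn qn /=.
  have n'0 : (0 < n %/ q)%N by rewrite divn_gt0 ?prime_gt0 // dvdn_leq.
  have n'Z : ((n %/ q)%N \in index_iota 1 Z.+1).
    by rewrite mem_index_iota n'0 /=; apply: leq_ltn_trans nZ; apply: leq_div.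
  rewrite [leRHS]big_mkcond (bigD1_seq (n %/ q)%N) ?iota_uniq //=.
  rewrite mulnC divnK // eqxx.
  rewrite -invfM -natrM mulnC divnK // lerDl.
  by apply: sumr_ge0 => i _; case: ifP => // _; rewrite mulr_ge0 ?invr_ge0 ?ler0n.
rewrite [leRHS]big_mkcond big_seq [leRHS]big_seq; apply: ler_sum => n' _.
rewrite /F.
have [le|] := boolP ((q * n' < Z.+1)%N && (0 < n')%N); last first.
  move=> H; rewrite big_seq_cond big_pred0 ?if_same //.
    by case: ifP => // _; rewrite mulr_ge0 ?invr_ge0 ?ler0n.
  move=> n; apply/negP => /andP[]; rewrite mem_index_iota => /andP[n0 nZ] /andP[_ /eqP E].
  move: H; rewrite -E nZ /= -eqn0Ngt => /eqP n'0.
  by rewrite E n'0 muln0 in n0.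
have /andP[lt n'0] := le.
have qn' : (0 < q * n')%N by rewrite muln_gt0 prime_gt0.
have inr : (q * n')%N \in index_iota 1 Z.+1 by rewrite mem_index_iota qn'.
case: ifPn => sm.
  apply: (le_trans (y := \sum_(1 <= n < Z.+1 | n == (q * n')%N) q%:R^-1 * n'%:R^-1)).
    rewrite [leLHS]big_mkcond [leRHS]big_mkcond; apply: ler_sum => n _.
    case: eqP; rewrite ?andbF // andbT; case: ifP => // _ _.
  by rewrite -big_filter filter_pred1_uniq ?iota_uniq // big_seq1.
rewrite big_pred0 // => n; apply/negP => /andP[/andP[sn _] /eqP E].
case/negP: sm; apply/allP => p; rewrite mem_primes => /and3P[pp _ pn'].
by apply: (allP sn); rewrite mem_primes pp E qn' /= dvdn_mull.
Qed.

(** Every [n] up to [Z] has all its prime factors up to [Z], so the sum in Euler's product is the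
    whole harmonic sum. *)
Lemma mertens_product Z :
  (\prod_(q <- primes_le Z) (1 - q%:R^-1)) * ln Z.+1%:R <= 1 :> R.
Proof.
have ap : all prime (primes_le Z) by apply/allP => p; rewrite mem_primes_le => /andP[].
apply: le_trans (euler_product_ge Z (primes_le_uniq Z) ap).
apply: ler_wpM2l.
  rewrite big_seq; apply: prodr_ge0 => p /(allP ap) pp; rewrite subr_ge0.
  by rewrite invf_le1 ?ler1n ?ltr0n prime_gt0.
apply: (le_trans (harmonic_ge Z)).
rewrite [leRHS]big_mkcond big_seq [leRHS]big_seq; apply: ler_sum => n.
rewrite mem_index_iota => /andP[n0 nZ]; rewrite ifT //.
apply/allP => p; rewrite mem_primes => /and3P[pp _ pn].
rewrite -[mem _ _]/(p \in primes_le Z) mem_primes_le pp /= -ltnS.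
by apply: leq_ltn_trans nZ; apply: dvdn_leq.
Qed.

(** The prime divisors of [D] above [y] have a product dividing [D], so there are at most [l] of
    them, each contributing at most [1 / y]. *)
Lemma recip_prime_divisors Z y D l : (0 < D)%N -> (0 < y)%N -> (D < 2 ^ l)%N ->
  \sum_(q <- primes_le Z | (q %| D)%N) q%:R^-1 <= prime_recip y + l%:R / y%:R :> R.
Proof.
move=> D0 y0 Dl; rewrite (bigID (fun q => (q <= y)%N)) /=; apply: lerD.
  rewrite -big_filter /prime_recip.
  apply: (le_trans (y := \sum_(q <- primes_le y | (q %| D)%N && (q <= Z)%N) q%:R^-1)).
    rewrite -[leRHS]big_filter le_eqVlt; apply/orP; left; apply/eqP.
    apply: perm_big; apply: uniq_perm; rewrite ?filter_uniq ?primes_le_uniq ?iota_uniq // => q.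
    rewrite !mem_filter !mem_iota !add0n !ltnS /=.
    by case: (prime q); case: (q %| D)%N; case: (q <= y)%N; case: (q <= Z)%N.
  rewrite big_mkcond; apply: ler_sum => q _; case: ifP => // _.
rewrite -big_filter; set s := [seq _ <- _ | _].
have y0' : 0 < y%:R :> R by rewrite ltr0n.
apply: (le_trans (y := \sum_(q <- s) y%:R^-1)).
  rewrite big_seq [leRHS]big_seq; apply: ler_sum => q; rewrite mem_filter -ltnNge => /andP[/andP[_ yq] _].
  rewrite lef_pV2 ?posrE ?ler_nat //; first exact: ltnW.
  by rewrite ltr0n; apply: leq_ltn_trans yq.
rewrite big_const_seq count_predT iter_addr_0 -[_ *+ _]mulr_natl.
rewrite ler_pM2r ?invr_gt0 // ler_nat.
rewrite leqNgt; apply/negP => ls.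
have us : uniq s by rewrite filter_uniq ?primes_le_uniq.
have as_ : all prime s.
  by apply/allP => p; rewrite mem_filter mem_primes_le => /and3P[].
have dv : (\prod_(p <- s) p %| D)%N.
  apply: prod_primes_dvd => // p; by rewrite mem_filter => /andP[/andP[]].
have := dvdn_leq D0 dv; apply/negP; rewrite -ltnNge.
apply: leq_trans Dl _; apply: (@leq_trans (2 ^ size s)%N).
  by rewrite leq_exp2l // ltnW.
elim: (s) as_ => [|p r IHr] /=; first by rewrite big_nil.
move=> /andP[pp ar]; rewrite big_cons expnS leq_mul ?prime_gt1 //; exact: IHr.
Qed.

Lemma one_sub_ge_exp (x : R) : 0 <= x -> x <= 2^-1 -> expR (- (2 * x)) <= 1 - x.
Proof.
move=> x0 x1; rewrite expRN.
have e0 : 0 < 1 + 2 * x by rewrite ltr_pwDl // mulr_ge0.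
apply: (le_trans (y := (1 + 2 * x)^-1)).
  by rewrite lef_pV2 ?posrE ?expR_gt0 // expR_ge1Dx.
rewrite -[leLHS]mul1r ler_pdivrMr //.
have -> : (1 - x) * (1 + 2 * x) = 1 + 2 * x * (2^-1 - x) by field.
by rewrite lerDl !mulr_ge0 // subr_ge0.
Qed.

(** The factors at primes dividing [D] are removed from Mertens' product. By [one_sub_ge_exp], valid
    since every prime is at least 2, this costs the exponential of twice the sum of their
    reciprocals. *)
Lemma mertens_product_coprime Z y D l : (0 < D)%N -> (0 < y)%N -> (D < 2 ^ l)%N ->
  (\prod_(q <- primes_le Z | ~~ (q %| D)%N) (1 - q%:R^-1)) * ln Z.+1%:R <=
    expR (2 * (prime_recip y + l%:R / y%:R)) :> R.
Proof.
move=> D0 y0 Dl.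
have := mertens_product Z; rewrite (bigID (fun q => (q %| D)%N)) /= => M.
set P1 := \prod_(_ <- _ | (_ %| D)%N) _ in M.
set P2 := \prod_(_ <- _ | ~~ _) _ in M *.
have pr q : q \in primes_le Z -> 0 <= (q%:R^-1 : R) <= 2^-1.
  rewrite mem_primes_le => /andP[pq _].
  rewrite invr_ge0 ler0n lef_pV2 ?posrE // ?ler_nat ?ltr0n ?prime_gt0 ?prime_gt1 //.
have L : expR (- (2 * (prime_recip y + l%:R / y%:R))) <= P1.
  apply: (le_trans (y := expR (- (2 * \sum_(q <- primes_le Z | (q %| D)%N) q%:R^-1)))).
    by rewrite ler_expR lerN2 ler_pM2l // recip_prime_divisors.
  rewrite mulr_sumr -sumrN expR_sum /P1 big_seq_cond [leRHS]big_seq_cond.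
  apply: ler_prod => q /andP[/pr/andP[a b] _]; rewrite expR_ge0 /=.
  exact: one_sub_ge_exp.
have P20 : 0 <= P2.
  rewrite /P2 big_seq_cond; apply: prodr_ge0 => q /andP[/pr/andP[_ b] _].
  by rewrite subr_ge0 (le_trans b) // invf_le1 // ler1n.
have ln0 : 0 <= ln Z.+1%:R :> R by rewrite ln_ge0 // ler1n.
have := le_trans (ler_wpM2r (mulr_ge0 P20 ln0) L) (_ : P1 * (P2 * ln Z.+1%:R) <= 1).
rewrite mulrA => /(_ M); rewrite expRN mulrC ler_pdivrMr ?expR_gt0 //.
by rewrite mul1r.
Qed.

End PrimeSums.

(** * Density increment and incidences *)

Definition ap_count (A : pred nat) (a W n : nat) : nat :=
  (\sum_(i < n) A (a + W * i))%N.

Lemma ap_count_le A a W n : (ap_count A a W n <= n)%N.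
Proof.
rewrite -[leqRHS]card_ord -sum1_card; apply: leq_sum => i _; exact: leq_b1.
Qed.

Section Increment.
Variables (R : realFieldType) (A : pred nat) (Bn K J n0 : nat) (rho0 eps : R).
Hypothesis Bn_gt0 : (0 < Bn)%N.
Hypothesis K_gt0 : (0 < K)%N.
Hypothesis rho0_gt0 : 0 < rho0.
Hypothesis eps_ge0 : 0 <= eps.
Hypothesis n0_large : ((2 * (Bn * K)) ^ J.+1 <= n0)%N.
Hypothesis J_large : 1 < (1 + eps) ^+ J * rho0.
Hypothesis dense : rho0 * n0%:R <= (ap_count A 0 1 n0)%:R.

(** Densities are compared after cross-multiplication. The start [a'] is arbitrary, so the competing
    progression need not lie inside the given one. *)
Definition no_increment (a W n : nat) : Prop :=
  forall a' h, (0 < h <= Bn)%N ->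
    (ap_count A a' (W * h) (n %/ (Bn * K)))%:R * n%:R <=
    (1 + eps) * (ap_count A a W n)%:R * (n %/ (Bn * K))%N%:R :> R.

(** Otherwise [J] successive increments would lift the density above 1 by [J_large]. Each one
    divides the length by at most [2 * (Bn * K)], for which [n0_large] leaves room, and keeps
    [W * n] bounded because [h <= Bn]. *)
Lemma exists_no_increment : exists a W n : nat,
  [/\ (0 < W)%N, (W * n <= n0)%N, (n0 <= n * (2 * (Bn * K)) ^ J)%N,
      rho0 * n%:R <= (ap_count A a W n)%:R & no_increment a W n].
Proof.
apply: contrapT => H.
have BK0 : (0 < Bn * K)%N by rewrite muln_gt0 Bn_gt0.
have e0 : 0 <= 1 + eps by rewrite addr_ge0.
have climb j : (j <= J)%N -> exists a W n : nat,
  [/\ (0 < W)%N, (W * n <= n0)%N, (n0 <= n * (2 * (Bn * K)) ^ j)%N &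
      (1 + eps) ^+ j * rho0 * n%:R <= (ap_count A a W n)%:R].
  elim: j => [|j IH] jJ.
    by exists 0%N, 1%N, n0; rewrite mul1n expn0 muln1 expr0 mul1r.
  have [a [W [n [W0 Wn nn0 d]]]] := IH (ltnW jJ).
  have nBK : (2 * (Bn * K) <= n)%N.
    rewrite -(@leq_pmul2r ((2 * (Bn * K)) ^ j)) ?expn_gt0 ?muln_gt0 ?Bn_gt0 ?K_gt0 //.
    rewrite -expnS; apply: leq_trans nn0; apply: leq_trans n0_large.
    by apply: leq_pexp2l; [rewrite muln_gt0 | apply: ltnW].
  have n_gt0 : 0 < n%:R :> R by rewrite ltr0n; lia.
  have [a' [h [hB inc]]] : exists a' h, (0 < h <= Bn)%N /\
    (1 + eps) * (ap_count A a W n)%:R * (n %/ (Bn * K))%N%:R <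
    (ap_count A a' (W * h) (n %/ (Bn * K)))%:R * n%:R :> R.
    apply: contrapT => H2; apply: H; exists a, W, n; split => //.
    - by apply: leq_trans nn0 _; rewrite leq_mul2l leq_pexp2l ?muln_gt0 ?Bn_gt0 ?orbT // ltnW.
    - apply: le_trans d; rewrite ler_wpM2r ?ler0n // ler_peMl //; first exact: ltW.
      by rewrite exprn_ege1 // lerDl.
    - by move=> a' h hB; rewrite leNgt; apply/negP => lt; apply: H2; exists a', h.
  set M := (n %/ (Bn * K))%N in inc *.
  (* Rounding down costs at most a factor 2, since the quotient is positive. *)
  have nM : (n <= 2 * (Bn * K) * M)%N.
    have M0 : (0 < M)%N by rewrite divn_gt0 //; lia.
    apply: ltnW; apply: leq_trans (ltn_ceil n BK0) _; rewrite mulnAC leq_mul2r -/M.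
    by apply/orP; right; lia.
  have Mn : (Bn * K * M <= n)%N by rewrite mulnC leq_trunc_div.
  case/andP: hB => h0 hB.
  exists a', (W * h)%N, M; split.
  - by rewrite muln_gt0 W0.
  - apply: leq_trans Wn; rewrite -mulnA leq_mul2l; apply/orP; right.
    apply: leq_trans Mn; rewrite leq_mul2r; apply/orP; right.
    by apply: leq_trans hB _; rewrite leq_pmulr.
  - apply: leq_trans nn0 _; rewrite expnS [(M * (_ * _))%N]mulnA leq_mul2r; apply/orP; right.
    by rewrite mulnC.
  - rewrite -(ler_pM2r n_gt0); apply: le_trans (ltW inc).
    have := ler_wpM2r (ler0n R M) (ler_wpM2l e0 d).
    apply: le_trans; rewrite le_eqVlt; apply/orP; left; apply/eqP.
    by rewrite exprS; ring.
have [a [W [n [W0 Wn nn0 d]]]] := climb J (leqnn J).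
have n_gt0 : 0 < n%:R :> R.
  rewrite ltr0n lt0n; apply/eqP => n0E; move: nn0; rewrite n0E mul0n leqn0 => /eqP E.
  by move: n0_large; rewrite E leqn0 expn_eq0 /= !muln_eq0 /= -!leqn0 leqNgt Bn_gt0 leqNgt K_gt0.
have up : (1 + eps) ^+ J * rho0 * n%:R <= n%:R.
  by apply: le_trans d _; rewrite ler_nat ap_count_le.
have lo : n%:R < (1 + eps) ^+ J * rho0 * n%:R by rewrite ltr_pMl.
by have := lt_le_trans lo up; rewrite ltxx.
Qed.

End Increment.

(** * Incidences between shifts and points, and their pair correlations *)

Section Incidence.
Variables (A : pred nat) (a W n Bn K : nat).
Let M := (n %/ (Bn * K))%N.
Let beta := (Bn * M)%N.
Let f y := (y < n)%N && A (a + W * y)%N.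

(* The pair w stands for the point x = w.1 - beta, which may be negative, and
   m = w.2 + 1. *)
Definition incident (b : 'I_Bn.+1) (w : 'I_(n + beta) * 'I_M) : bool :=
  let y := (w.1 + b * w.2.+1)%N in (beta <= y)%N && f (y - beta)%N.

(** The window of length [n + beta] contains every translate of the progression by at most [beta].
    No boundary terms are lost, so the size of [S_b] does not depend on [b]. *)
Lemma sum_shift (F : nat -> nat) d : (d <= beta)%N -> (forall y, (n <= y)%N -> F y = 0%N) ->
  (\sum_(x < n + beta) (if beta <= x + d then F (x + d - beta) else 0) =
   \sum_(y < n) F y)%N.
Proof.
move=> db F0.
rewrite -(big_mkord predT (fun x => if (beta <= x + d)%N then F (x + d - beta)%N else 0%N)).
rewrite -(big_mkord predT F).
rewrite (big_cat_nat (n := (beta - d)%N)) //=; last by lia.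
rewrite [X in (X + _)%N]big1_seq ?add0n; last first.
  by move=> x; rewrite mem_index_iota => /andP[_ /andP[_ xl]]; rewrite ifF //; lia.
rewrite -{1}[(beta - d)%N]add0n big_addn.
have -> : (n + beta - (beta - d) = n + d)%N by lia.
rewrite (big_cat_nat (n := n)) ?leq_addr //= [X in (_ + X)%N]big1_seq ?addn0; last first.
  move=> y; rewrite mem_index_iota => /andP[_ /andP[ny _]].
  by case: ifP => // _; apply: F0; lia.
apply: eq_bigr => y _; rewrite ifT; last by lia.
by congr F; lia.
Qed.

Lemma mul_le_beta (b : 'I_Bn.+1) (j : 'I_M) : (b * j.+1 <= beta)%N.
Proof. by rewrite leq_mul // -ltnS. Qed.

Lemma card_pairs (P : 'I_(n + beta) -> 'I_M -> bool) :
  #|[set w : 'I_(n + beta) * 'I_M | P w.1 w.2]%SET| = (\sum_j \sum_x P x j)%N.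
Proof.
rewrite exchange_big pair_big /= -sum1_card big_mkcond /=.
by apply: eq_bigr => w _; rewrite inE; case: (P _ _).
Qed.

Lemma card_incident b : #|[set w | incident b w]%SET| = (M * ap_count A a W n)%N.
Proof.
rewrite (card_pairs (fun x j => incident b (x, j))).
have -> : (M * ap_count A a W n = \sum_(j < M) ap_count A a W n)%N.
  by rewrite sum_nat_const card_ord.
apply: eq_bigr => j _.
have -> : ap_count A a W n = (\sum_(y < n) f y)%N.
  by apply: eq_bigr => y _; rewrite /f ltn_ord.
apply: etrans (@sum_shift (fun y => f y : nat) _ (mul_le_beta b j) _).
  by apply: eq_bigr => x _; rewrite /incident /=; case: ifP.
by move=> y ny; rewrite /f ltnNge ny.
Qed.

(** With the first point fixed in [A], the second runs, as [m] varies, through a progression of step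
    [W * (b' - b)], to which the absence of an increment applies. *)
Lemma card_incident2 (R : realFieldType) (eps : R) b b' :
  no_increment A Bn K eps a W n -> b != b' ->
  #|[set w | incident b w && incident b' w]%SET|%:R * n%:R <=
  (1 + eps) * (ap_count A a W n)%:R ^+ 2 * M%:R.
Proof.
move=> noinc; wlog bb' : b b' / (b < b')%N => [hw nbb'|_].
  have : (b != b' :> nat) by [].
  rewrite neq_ltn => /orP[lt|gt]; first exact: hw.
  have -> : [set w | incident b w && incident b' w]%SET = [set w | incident b' w && incident b w]%SET.
    by apply/setP => w; rewrite !inE andbC.
  by apply: hw => //; rewrite eq_sym.
set h := (b' - b)%N.
have hB : (0 < h <= Bn)%N.
  rewrite subn_gt0 bb' /=; apply: leq_trans (leq_subr _ _) _; by rewrite -ltnS.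
rewrite (card_pairs (fun x j => incident b (x, j) && incident b' (x, j))).
have E (j : 'I_M) : (\sum_(x < n + beta) (incident b (x, j) && incident b' (x, j)) =
    \sum_(y < n) (f y && f (y + h * j.+1)))%N.
  apply: etrans (@sum_shift (fun y => (f y && f (y + h * j.+1)%N) : nat) _ (mul_le_beta b j) _).
    apply: eq_bigr => x _; rewrite /incident /=; case: leqP => //= bx.
    have -> : (x + b' * j.+1 = x + b * j.+1 + h * j.+1)%N.
      by rewrite -addnA -mulnDl subnKC // ltnW.
    by rewrite (leq_trans bx (leq_addr (h * j.+1) _)) /= addnBAC.
  by move=> y ny; rewrite /f ltnNge ny.
under eq_bigr do rewrite E.
rewrite exchange_big /= natr_sum mulr_suml.
have -> : (1 + eps) * (ap_count A a W n)%:R ^+ 2 * M%:R =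
  \sum_(y < n) (A (a + W * y))%N%:R * ((1 + eps) * (ap_count A a W n)%:R * M%:R).
  by rewrite -mulr_suml -natr_sum -/(ap_count _ _ _ _); ring.
apply: ler_sum => y _.
have -> : f y = A (a + W * y)%N by rewrite /f ltn_ord.
case Ay : (A (a + W * y)%N); last first.
  by rewrite big1 // ?mul0r.
(* The progression starts one step after the first point, since [m = j + 1] is at least 1. *)
rewrite mul1r; apply: le_trans (noinc (a + W * y + W * h)%N h hB).
rewrite ler_wpM2r ?ler0n // ler_nat; apply: leq_sum => j _ /=.
rewrite /f; have -> : (a + W * (y + h * j.+1) = a + W * y + W * h + W * h * j)%N by ring.
by case: (_ < _)%N.
Qed.

End Incidence.

(** * Sieving tuples *)

Section TupleSieve.
Variables (A : pred nat) (a W n Bn K t : nat).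
Hypothesis A_prime : forall p, A p -> prime p.
Hypothesis W_gt0 : (0 < W)%N.
Let M := (n %/ (Bn * K))%N.
Let beta := (Bn * M)%N.
Variable b : 'I_t -> 'I_Bn.+1.
Hypothesis b_inj : injective b.

(** The prime [q] divides one of the values [a + W * (x + b i * m - beta)]; moving [W * beta] across
    the congruence avoids truncated subtraction. *)
Definition hits (m q x : nat) : bool :=
  [exists i, a + W * (x + b i * m) == W * beta %[mod q]].

(** For a prime [q] not dividing it, each of the [t] linear forms in [x] has one root modulo [q] and
    these roots are distinct. Ordering the pairs keeps the natural differences positive. *)
Definition discriminant (m : nat) : nat :=
  (W * m * \prod_i \prod_(i' | b i < b i') (b i' - b i))%N.

Lemma discriminant_gt0 m : (0 < m)%N -> (0 < discriminant m)%N.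
Proof.
move=> m0; rewrite !muln_gt0 W_gt0 m0 /=.
by apply: prodn_gt0 => i; apply: prodn_cond_gt0 => i' h; rewrite subn_gt0.
Qed.

Lemma discriminant_le m : (0 < Bn)%N -> (m <= M)%N ->
  (discriminant m <= W * M * Bn ^ (t * t))%N.
Proof.
move=> B0 mM; apply: leq_mul; first by rewrite leq_mul2l mM orbT.
have -> : (Bn ^ (t * t) = \prod_(i < t) Bn ^ t)%N by rewrite prod_nat_const card_ord expnM.
apply: leq_prod => i _.
have -> : (Bn ^ t = \prod_(i < t) Bn)%N by rewrite prod_nat_const card_ord.
rewrite big_mkcond; apply: leq_prod => i' _; case: ifP => // _.
by apply: leq_trans (leq_subr _ _) _; rewrite -ltnS.
Qed.

Lemma sievable_hits m q : prime q -> ~~ (q %| discriminant m)%N ->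
  sievable t (hits m) q.
Proof.
move=> pq qD; split=> //.
  move=> x; apply: eq_existsb => i.
  have E : (a + W * (x + b i * m) = a + W * (x %% q + b i * m) %[mod q])%N.
    rewrite {1}(divn_eq x q).
    have -> : (a + W * (x %/ q * q + x %% q + b i * m) =
      W * (x %/ q) * q + (a + W * (x %% q + b i * m)))%N by ring.
    by rewrite modnMDl.
  by rewrite E.
have q0 := prime_gt0 pq.
move: qD; rewrite /discriminant !Euclid_dvdM // !negb_or => /andP[/andP[qW qm]].
rewrite Euclid_dvd_prod // big_has => /hasPn qd.
have lincancel (x y c : nat) : (y <= x)%N ->
    (a + W * (x + c) == a + W * (y + c) %[mod q]) -> (q %| x - y)%N.
  move=> yx; rewrite eqn_mod_dvd ?leq_add2l ?leq_mul2l ?leq_add2r ?yx ?orbT //.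
  by rewrite subnDl -mulnBr subnDr Euclid_dvdM // (negbTE qW).
pose root i (r : 'I_q) := (a + W * (r + b i * m) == W * beta %[mod q]).
(* An injective map of the residues modulo [q] to themselves is bijective, so each form has exactly
   one root. *)
have one i : (\sum_(r < q) root i r = 1)%N.
  pose phi (r : 'I_q) : 'I_q := Ordinal (ltn_pmod (a + W * (r + b i * m)) q0).
  have phi_inj : injective phi.
    suff H (r r' : 'I_q) : (r' <= r)%N -> phi r = phi r' -> r = r'.
      move=> r r'; case/orP: (leq_total r' r) => le E; first exact: H.
      by symmetry; apply: H.
    move=> le [/eqP/(lincancel _ _ _ le)/eqP].
    rewrite modn_small; last by apply: leq_ltn_trans (ltn_ord r); apply: leq_subr.
    by move=> /eqP; rewrite subn_eq0 => le'; apply: val_inj; apply/eqP; rewrite eqn_leq le le'.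
  have [psi _ psiK] := injF_bij phi_inj.
  set r0 := psi (Ordinal (ltn_pmod (W * beta) q0)).
  have r0E : phi r0 = Ordinal (ltn_pmod (W * beta) q0) by apply: psiK.
  have rootE r : root i r = (r == r0).
    by rewrite -(inj_eq phi_inj) r0E -val_eqE.
  under eq_bigr do rewrite rootE.
  by rewrite -big_mkcond sum1_card card1.
(* A shared root would make [q] divide [m * (b i' - b i)]. *)
have disj i i' r : root i r -> root i' r -> i = i'.
  suff H i1 i2 : (b i1 < b i2)%N -> root i1 r -> root i2 r -> False.
    move=> ri ri'; apply: b_inj; apply: val_inj => /=.
    by case: (ltngtP (b i) (b i')) => // lt; [case: (H _ _ lt ri ri') | case: (H _ _ lt ri' ri)].
  move: i1 i2 => {i i'} i i' lt; rewrite /root => /eqP<- /eqP E.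
  have : (q %| b i' * m - b i * m)%N.
    apply: (lincancel _ _ r); first by rewrite leq_mul2r ltnW ?orbT.
    by rewrite ![(_ + r)%N]addnC; apply/eqP.
  rewrite -mulnBl Euclid_dvdM // (negbTE qm) orbF => dv.
  have := qd i (mem_index_enum i); rewrite Euclid_dvd_prod // big_has_cond => /hasPn/(_ i' (mem_index_enum i')).
  by rewrite /= lt dv.
have -> : t = (\sum_(i < t) \sum_(r < q) root i r)%N.
  by under eq_bigr do rewrite one; rewrite sum1_card card_ord.
rewrite exchange_big big_mkcond; apply: eq_bigr => r _ /=.
case: ifPn => [/existsP[i ri]|/existsPn nr].
  rewrite (bigD1 i) //= [root i r](_ : _ = true) // big1 // => i' ne.
  by apply/eqP; rewrite eqb0; apply: contra ne => ri'; apply/eqP; exact: (disj _ _ r).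
by rewrite big1 // => i _; apply/eqP; rewrite eqb0; apply: nr.
Qed.

Let X := (n + beta)%N.

(** Every incident value is prime, so a prime [q <= Z] dividing it equals it. Such small values
    occur for at most [Z.+1] choices of [x] per form; all other [x] survive the sieve. *)
Lemma sum_all_incident (j : 'I_M) Z :
  (\sum_(x < X) [forall i, @incident A a W n Bn K (b i) (x, j)] <=
   \sum_(x < X | all (fun q => ~~ hits j.+1 q x)
      [seq q <- primes_le Z | ~~ (q %| discriminant j.+1)%N]) 1 + t * Z.+1)%N.
Proof.
pose y (x : 'I_X) i := (x + b i * j.+1 - beta)%N.
pose small (x : 'I_X) i := [&& beta <= x + b i * j.+1 & a + W * y x i <= Z]%N.
have smallZ i : (\sum_(x < X) small x i <= Z.+1)%N.
  rewrite -big_mkcond sum1_card.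
  pose phi (x : 'I_X) : 'I_Z.+1 := inord (a + W * y x i).
  rewrite -[leqRHS]card_ord -(card_in_imset (f := phi)); first exact: max_card.
  move=> x x' /andP[bx sx] /andP[bx' sx'] /(congr1 val).
  rewrite /phi /= !inordK // => /addnI/eqP; rewrite eqn_mul2l (gtn_eqF W_gt0) /= /y => /eqP E.
  by apply: val_inj => /=; lia.
apply: (@leq_trans (\sum_(x < X) (all (fun q => ~~ hits j.+1 q x)
      [seq q <- primes_le Z | ~~ (q %| discriminant j.+1)%N] + \sum_(i < t) small x i))%N); last first.
  rewrite big_split /= -big_mkcond leq_add2l exchange_big /=.
  apply: leq_trans (leq_sum _ (fun i _ => smallZ i)) _.
  by rewrite sum_nat_const card_ord.
apply: leq_sum => x _.
case: forallP => //= H.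
case: (boolP [exists i, small x i]) => [/existsP[i si]|].
  by rewrite (bigD1 i) //= si addnCA leq_addr.
rewrite negb_exists => /forallP ns.
suff -> : all (fun q => ~~ hits j.+1 q x)
  [seq q <- primes_le Z | ~~ (q %| discriminant j.+1)%N] by rewrite leq_addr.
apply/allP => q; rewrite mem_filter mem_primes_le => /and3P[_ pq qZ].
apply/negP => /existsP[i hi].
have := H i; rewrite /incident /= => /andP[bx /andP[_ /A_prime pP]].
have := ns i; rewrite /small bx /= -ltnNge => Zlt.
have : (q %| a + W * y x i)%N.
  have E : (a + W * (x + b i * j.+1) = a + W * y x i + W * beta)%N.
    by rewrite -addnA -mulnDr subnK.
  by move: hi; rewrite E -{2}[(W * beta)%N]add0n eqn_modDr mod0n.
rewrite dvdn_prime2 // => /eqP E.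
by move: Zlt; rewrite -E ltnNge qZ.
Qed.

End TupleSieve.

Section TupleSieveReal.
Variables (R : realType) (A : pred nat) (a W n Bn K t l y s Z : nat).
Hypothesis A_prime : forall p, A p -> prime p.
Hypothesis W_gt0 : (0 < W)%N.
Hypothesis Bn_gt0 : (0 < Bn)%N.
Let M := (n %/ (Bn * K))%N.
Let X := (n + Bn * M)%N.
Hypothesis D_small : (W * M * Bn ^ (t * t) < 2 ^ l)%N.
Hypothesis y_gt0 : (0 < y)%N.
Hypothesis Z_gt0 : (0 < Z)%N.
Hypothesis s_odd : odd s.

(** For each [m] the sieve runs over [x], leaving out the primes that divide the discriminant; the
    product left over is compared with the [t]-th power of Mertens' product. *)
Lemma card_common_incident (b : {ffun 'I_t -> 'I_Bn.+1}) : injective b ->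
  #|common (@incident A a W n Bn K) b|%:R <= 
  M%:R * (X%:R * ((expR (2 * (prime_recip R y + l%:R / y%:R)) / ln Z.+1%:R) ^+ t +
      expR (4 * t%:R * prime_recip R Z) / 4 ^+ s) +
      ((1 + t * Z.+1) ^ s)%:R + (t * Z.+1)%:R) :> R.
Proof.
move=> b_inj.
rewrite /common (card_pairs (fun x j => [forall i, @incident A a W n Bn K (b i) (x, j)])).
rewrite natr_sum mulr_natl -[M in leRHS]card_ord -sumr_const; apply: ler_sum => j _.
apply: (le_trans (y := _%:R)); first by rewrite ler_nat; apply: (sum_all_incident a A_prime W_gt0 b j Z).
rewrite natrD lerD2r.
set P := [seq _ <- _ | _].
have D0 : (0 < discriminant W b j.+1)%N by apply: discriminant_gt0.
have Dl : (discriminant W b j.+1 < 2 ^ l)%N.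
  by apply: leq_ltn_trans D_small; exact: discriminant_le.
have sP : {in P, forall q, sievable t (hits a W n K b j.+1) q}.
  move=> q; rewrite mem_filter mem_primes_le => /and3P[qD pq _].
  exact: sievable_hits.
have uP : uniq P by rewrite filter_uniq ?primes_le_uniq.
have prP q : q \in P -> prime q by move=> /sP[].
apply: (le_trans (brun_sieve R X s_odd sP uP)).
have szP : (size P <= Z.+1)%N.
  rewrite size_filter; apply: leq_trans (count_size _ _) _.
  by rewrite size_filter; apply: leq_trans (count_size _ _) _; rewrite size_iota.
apply: lerD; last first.
  by rewrite ler_nat; case: (s) => // s'; rewrite leq_exp2r // leq_add2l leq_mul2l szP orbT.
rewrite ler_wpM2l ?ler0n //; apply: lerD; last first.
  rewrite ler_pM2r ?invr_gt0 ?exprn_gt0 //.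
  rewrite /prime_recip mulr_sumr.
  apply: (le_trans (y := expR (\sum_(q <- P) 4 * t%:R * q%:R^-1))).
    rewrite expR_sum big_seq [leRHS]big_seq; apply: ler_prod => q _.
    rewrite addr_ge0 ?mulr_ge0 ?divr_ge0 ?ler0n //= mulrA; exact: expR_ge1Dx.
  rewrite ler_expR /P big_filter [leLHS]big_mkcond; apply: ler_sum => q _.
  by case: ifP => // _; rewrite !mulr_ge0 ?invr_ge0 ?ler0n.
have lnZ : 0 < ln Z.+1%:R :> R by rewrite ln_gt0 // ltr1n.
apply: (le_trans (y := (\prod_(q <- P) (1 - q%:R^-1)) ^+ t)); last first.
  have Pge : 0 <= \prod_(q <- P) (1 - q%:R^-1) :> R.
    rewrite big_seq; apply: prodr_ge0 => q /prP pq; rewrite subr_ge0.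
    by rewrite invf_le1 ?ler1n ?ltr0n prime_gt0.
  rewrite lerXn2r ?nnegrE //; first by rewrite divr_ge0 ?expR_ge0 // ltW.
  rewrite ler_pdivlMr // /P big_filter; exact: mertens_product_coprime.
rewrite -prodrXl big_seq [leRHS]big_seq; apply: ler_prod => q /[dup] /sP[pq _ tE] qP.
have q0 : 0 < q%:R :> R by rewrite ltr0n prime_gt0.
have i1 : q%:R^-1 <= 1 :> R by rewrite invf_le1 // ler1n prime_gt0.
have tq : (t <= q)%N.
  rewrite -{1}tE; apply: leq_trans (_ : (\sum_(r < q) 1 <= q)%N); last by rewrite sum1_card card_ord.
  by rewrite [leqLHS]big_mkcond; apply: leq_sum => r _; case: ifP.
rewrite subr_ge0 ler_pdivrMr // mul1r ler_nat tq /=.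
(* Bernoulli's inequality: [1 - t / q] is at most [(1 - 1 / q) ^ t]. *)
elim: (t) => [|u IH]; first by rewrite mul0r subr0 expr0.
rewrite exprS; apply: le_trans (_ : (1 - q%:R^-1) * (1 - u%:R / q%:R) <= _).
  rewrite -natr1 -subr_ge0.
  have -> : (1 - q%:R^-1) * (1 - u%:R / q%:R) - (1 - (u%:R + 1) / q%:R) = 
    u%:R * q%:R^-1 ^+ 2 :> R by field; rewrite gt_eqF.
  by rewrite mulr_ge0 ?ler0n ?sqr_ge0.
by rewrite ler_wpM2l // subr_ge0.
Qed.

End TupleSieveReal.

(** * Increment, sieve and second moment combined, with free parameters *)

Section Core.
Variables (R : realType) (A : pred nat) (k Bn K J n0 l y s Z : nat).
Variables (V : {set 'I_Bn.+1}) (rho0 eps u H e1 : R).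
Let t := (2 * k.-1)%N.
Hypothesis A_prime : forall p, A p -> prime p.
Hypothesis k_gt1 : (1 < k)%N.
Hypothesis Bn_gt0 : (0 < Bn)%N.
Hypothesis y_gt0 : (0 < y)%N.
Hypothesis Z_gt0 : (0 < Z)%N.
Hypothesis s_odd : odd s.
Hypothesis rho0_gt0 : 0 < rho0.
Hypothesis eps_gt0 : 0 < eps.
Hypothesis eps_le : 3 * eps <= 1.
Hypothesis K_large : 1 <= eps * K%:R.
Hypothesis H_ge1 : 1 <= H.
Hypothesis u_gt0 : 0 < u.
Hypothesis n0_large : ((2 * (Bn * K)) ^ J.+1 <= n0)%N.
Hypothesis J_large : 1 < (1 + eps) ^+ J * rho0.
Hypothesis dense : rho0 * n0%:R <= (ap_count A 0 1 n0)%:R.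
Hypothesis V_gt0 : (0 < #|V|)%N.
Hypothesis V_large : 1 <= 3 * eps * (#|V|%:R * (rho0 / 2) ^+ 2).
Hypothesis V_large_t : (t ^ 2)%:R <= #|V|%:R * (rho0 / 2) ^+ (2 * t).
Hypothesis D_small : (n0 * Bn ^ (t * t) < 2 ^ l)%N.
Hypothesis sieve_err : 
  ((1 + t * Z.+1) ^ s + t * Z.+1)%:R * ((2 * (Bn * K)) ^ J)%:R <= e1 * n0%:R.
Hypothesis sieve_main :
  (expR (2 * (prime_recip R y + l%:R / y%:R)) / ln Z.+1%:R) ^+ t +
    expR (4 * t%:R * prime_recip R Z) / 4 ^+ s + e1 <= H * (rho0 / 2) ^+ t.

Lemma few_tuples_without_config : exists bad : {set {ffun 'I_k -> 'I_Bn.+1}},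
  [/\ bad \subset tuple_on V k,
      #|bad|%:R <= k%:R * (6 * u * eps + H ^+ 2 / u) * #|V|%:R ^+ k &
      forall b, b \in tuple_on V k -> b \notin bad ->
        exists (x : int) (m : nat), [/\ (0 < m)%N, (m * (Bn * K) <= n0)%N &
          forall i, exists2 p, A p & p%:Z = x + (b i : nat)%:Z * m%:Z]].
Proof.
have K_gt0 : (0 < K)%N.
  rewrite lt0n; apply/eqP => K0; move: K_large; rewrite K0 mulr0; lra.
have [a [W [n [W0 Wn nn0 dn noinc]]]] :=
  exists_no_increment Bn_gt0 K_gt0 rho0_gt0 (ltW eps_gt0) n0_large J_large dense.
set M := (n %/ (Bn * K))%N in noinc.
set beta := (Bn * M)%N.
have BK0 : (0 < Bn * K)%N by rewrite muln_gt0 Bn_gt0.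
have nBK : (2 * (Bn * K) <= n)%N.
  rewrite -(@leq_pmul2r ((2 * (Bn * K)) ^ J)) ?expn_gt0 ?muln_gt0 ?Bn_gt0 ?K_gt0 //.
  by rewrite -expnS; apply: leq_trans nn0.
have BKn : (Bn * K <= n)%N by apply: leq_trans nBK; rewrite leq_pmull.
have M0 : (0 < M)%N by rewrite divn_gt0.
have n0' : (0 < n)%N by apply: leq_trans BKn.
have MBK : (M * (Bn * K) <= n)%N by apply: leq_trunc_div.
have n_gt0 : 0 < n%:R :> R by rewrite ltr0n.
have beta_le : beta%:R * K%:R <= n%:R :> R.
  by rewrite -natrM ler_nat /beta -mulnA mulnCA.
have Kr : 0 < K%:R :> R by rewrite ltr0n.
set cnt := ap_count A a W n in dn.
have cnt_gt0 : 0 < cnt%:R :> R by apply: lt_le_trans dn; rewrite mulr_gt0.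
have nb_gt0 : 0 < (n + beta)%:R :> R by rewrite ltr0n addn_gt0 n0'.
have nb_le : (n + beta)%:R <= (1 + eps) * n%:R :> R.
  rewrite natrD mulrDl mul1r lerD2l -(ler_pM2r Kr); apply: le_trans beta_le _.
  by rewrite mulrAC ler_peMl // ltW.
have eps1 : eps <= 1 by move: eps_le eps_gt0; lra.
(* The density in the enlarged window, for which the one-point count is an equality. As [beta] is at
   most [eps * n], it stays above [rho0 / 2]. *)
pose rho : R := cnt%:R / (n + beta)%:R.
have rho_gt0 : 0 < rho by rewrite divr_gt0.
have rho_ge : rho0 / 2 <= rho.
  rewrite ler_pdivlMr //; apply: le_trans dn.
  apply: (le_trans (y := rho0 / 2 * (2 * n%:R))).
    rewrite ler_pM2l ?divr_gt0 //; apply: le_trans nb_le _; rewrite ler_pM2r //; lra.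
  by rewrite mulrA divfK.
have h0 : 0 <= rho0 / 2 by rewrite divr_ge0 // ltW.
pose S := @incident A a W n Bn K.
set Om := ('I_(n + beta) * 'I_M)%type.
have cardOm : #|{: Om}|%:R = (n + beta)%:R * M%:R :> R.
  by rewrite card_prod !card_ord natrM.
have Om_gt0 : 0 < #|{: Om}|%:R :> R by rewrite cardOm mulr_gt0 // ltr0n.
exists [set b in tuple_on V k | #|common S b| == 0%N]%SET; split.
- by apply/fintype.subsetP => b; rewrite inE => /andP[].
(* The second moment method is run with [3 * eps]: one factor [1 + eps] comes from [no_increment],
   another from the enlarged window. *)
- have -> : 6 * u * eps = 2 * u * (3 * eps) by ring.
  apply: (few_uncommon (rho := rho)) => //.
  + by rewrite ltr0n.
  + by rewrite mulr_ge0 // ltW.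
  + apply: le_trans V_large _; rewrite ler_pM2l; last by rewrite mulr_gt0.
    by rewrite ler_wpM2l ?ler0n // lerXn2r // nnegrE ltW.
  + apply: le_trans V_large_t _.
    by rewrite ler_wpM2l ?ler0n // lerXn2r // nnegrE ltW.
  + move=> b _; rewrite card_incident natrM cardOm -/M -/cnt.
    by rewrite [RHS]mulrA divfK ?gt_eqF // mulrC.
  + move=> b b' _ _ bb'.
    have := card_incident2 noinc bb'; rewrite -/M -/cnt -/S.
    rewrite cardOm => ub.
    rewrite -(ler_pM2r n_gt0); apply: le_trans ub _.
    have -> : (1 + 3 * eps) * rho ^+ 2 * ((n + beta)%:R * M%:R) * n%:R =
       (cnt%:R ^+ 2 * M%:R) * ((1 + 3 * eps) * n%:R / (n + beta)%:R).
      rewrite /rho; move: nb_gt0; move: ((n + beta)%:R : R) => X X_gt0.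
      by field; rewrite gt_eqF.
    have -> : (1 + eps) * cnt%:R ^+ 2 * M%:R = (cnt%:R ^+ 2 * M%:R) * (1 + eps) by ring.
    rewrite ler_wpM2l ?mulr_ge0 ?sqr_ge0 ?ler0n // ler_pdivlMr //.
    apply: (le_trans (y := (1 + eps) * ((1 + eps) * n%:R))).
      by rewrite ler_wpM2l // addr_ge0 // ltW.
    rewrite mulrA ler_pM2r //.
    have : eps * eps <= eps by rewrite ler_piMr // ltW.
    have -> : (1 + eps) * (1 + eps) = 1 + 2 * eps + eps * eps by ring.
    lra.
  + move=> b _ b_inj.
    have DM : (W * M * Bn ^ (t * t) < 2 ^ l)%N.
      apply: leq_ltn_trans D_small; rewrite leq_mul2r; apply/orP; right.
      by apply: leq_trans Wn; rewrite leq_mul2l leq_div orbT.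
    have := card_common_incident R a A_prime W0 Bn_gt0 DM y_gt0 Z_gt0 s_odd b_inj.
    rewrite -/M -/beta -/S -/t => ub; apply: le_trans ub _.
    rewrite cardOm.
    set X : R := (n + beta)%:R; set m1 := (_ / ln _) ^+ _; set m2 := expR _ / _.
    have errX : ((1 + t * Z.+1) ^ s)%:R + (t * Z.+1)%:R <= e1 * X.
      rewrite -natrD.
      have BKJ : 0 < ((2 * (Bn * K)) ^ J)%:R :> R.
        by rewrite ltr0n expn_gt0 muln_gt0 BK0.
      rewrite -(ler_pM2r BKJ); apply: le_trans sieve_err _.
      have e10 : 0 <= e1.
        rewrite -(pmulr_lge0 _ (x := n0%:R)); first exact: le_trans sieve_err.
        rewrite ltr0n; apply: leq_trans n0_large; by rewrite expn_gt0 muln_gt0 BK0.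
      rewrite -mulrA ler_wpM2l // /X -natrM ler_nat; apply: leq_trans nn0 _.
      by rewrite leq_mul2r leq_addr orbT.
    apply: (le_trans (y := M%:R * (X * (m1 + m2 + e1)))).
      rewrite ler_wpM2l ?ler0n // -addrA [X * (_ + e1)]mulrDr lerD2l [X * e1]mulrC.
      exact: errX.
    apply: (le_trans (y := M%:R * (X * (H * (rho0 / 2) ^+ t)))).
      by rewrite !ler_wpM2l ?ler0n.
    have -> : H * rho ^+ t * (X * M%:R) = M%:R * (X * (H * rho ^+ t)) by ring.
    rewrite !ler_wpM2l ?ler0n //; first by apply: le_trans H_ge1.
    by rewrite lerXn2r // nnegrE ltW.
- move=> b bV; rewrite inE bV /= -lt0n => /card_gt0P[[x j]].
  rewrite inE => /forallP bS.
  (* Index [x + b * m - beta] of the progression is the integer [a + W * (x - beta) + b * (W * m)],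
     so the common difference parameter is [W * m] and the base point may be negative. *)
  exists (a%:Z + (W * x)%:Z - (W * beta)%:Z), (W * j.+1)%N; split.
  + by rewrite muln_gt0 W0.
  + apply: leq_trans Wn; rewrite -mulnA leq_mul2l; apply/orP; right.
    by apply: leq_trans MBK; rewrite leq_mul2r ltn_ord orbT.
  + move=> i; have := bS i; rewrite /S /incident /= => /andP[bx /andP[_ Ap]].
    eexists; first exact: Ap.
    rewrite PoszD mulnBr -subzn; last by rewrite leq_mul2l bx orbT.
    by rewrite mulnDr PoszD !PoszM /beta; ring.
Qed.

End Core.

(** * Choice of parameters *)

Section Growth.
Variable R : realType.

Lemma truncn_leR (x : R) : 0 <= x -> (Num.truncn x)%:R <= x.
Proof. by move=> x0; have /andP[] := truncn_itv x0. Qed.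

Lemma truncnS_gtR (x : R) : 0 <= x -> x < (Num.truncn x).+1%:R.
Proof. by move=> x0; have /andP[] := truncn_itv x0. Qed.

Lemma truncnS_le2 (x : R) : 1 <= x -> (Num.truncn x).+1%:R <= 2 * x.
Proof.
by move=> x1; rewrite -natr1; have := truncn_leR (le_trans ler01 x1); lra.
Qed.

Lemma expR_dominates (C : R) (d : nat) :
  exists x0 : R, forall x, x0 <= x -> C * x ^+ d <= expR x.
Proof.
exists (Num.max 0 (C * d.+1`!%:R)) => x; rewrite ge_max => /andP[x0 Cx].
apply: le_trans (expR_ge1Dxn d x0).
have f0 : 0 < d.+1`!%:R :> R by rewrite ltr0n fact_gt0.
rewrite -[leLHS]add0r lerD // exprS mulrAC ler_wpM2r ?exprn_ge0 //.
by rewrite ler_pdivlMr.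
Qed.

Lemma ln_dominated (C : R) (d : nat) :
  exists x0 : R, forall x, x0 <= x -> C * ln x ^+ d <= x.
Proof.
have [y0 H] := expR_dominates C d.
exists (expR y0) => x xy.
have x0 : 0 < x by apply: lt_le_trans xy; apply: expR_gt0.
rewrite -[leRHS](lnK (x := x)) ?posrE //; apply: H.
by rewrite -(expRK y0) ler_ln ?posrE ?expR_gt0.
Qed.

Lemma expR_half_le2 : expR 2^-1 <= 2 :> R.
Proof.
have := expR_ge1Dx (- 2^-1 : R); rewrite expRN => H.
rewrite -[leRHS]invrK -lef_pV2 ?posrE ?expR_gt0 ?invr_gt0 ?invrK //.
by apply: le_trans H; lra.
Qed.

Lemma expR_le_exp2 (x : R) (n : nat) : x <= n%:R -> expR (x / 2) <= 2 ^+ n.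
Proof.
move=> xn; apply: (le_trans (y := expR (n%:R * 2^-1))).
  by rewrite ler_expR ler_pM2r ?invr_gt0.
rewrite expRM_natl lerXn2r ?nnegrE ?expR_ge0 //; exact: expR_half_le2.
Qed.

Lemma expR_le_exp_1D (eps : R) (n : nat) : 0 <= eps -> eps <= 1 ->
  expR (n%:R * (eps / 2)) <= (1 + eps) ^+ n.
Proof.
move=> e0 e1; have e2 : 0 < 1 + eps by rewrite ltr_pwDl.
rewrite expRM_natl lerXn2r ?nnegrE ?expR_ge0 ?addr_ge0 //.
have := expR_ge1Dx (- (eps / 2)); rewrite expRN => H.
rewrite -[leRHS]invrK -lef_pV2 ?posrE ?expR_gt0 ?invr_gt0 ?invrK //.
apply: le_trans H; rewrite -[leLHS]mul1r ler_pdivrMr //.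
have -> : (1 + - (eps / 2)) * (1 + eps) = 1 + (eps - eps * eps) / 2 by field.
have : eps * eps <= eps by rewrite ler_piMr.
lra.
Qed.

(** Chebyshev's lower bound: logarithms are taken in [central_bin_primes] at half of [N]. *)
Lemma prime_pi_ge (N : R) : 8 <= N -> N <= 8 * ln N * (prime_pi N)%:R.
Proof.
move=> N8; have N0 : 0 < N by apply: lt_le_trans N8.
have N20 : 0 <= N / 2 by rewrite divr_ge0 // ltW.
set n := Num.truncn (N / 2).
have nN : 2 * n%:R <= N by have := truncn_leR N20; rewrite -/n; lra.
have Nn : N / 2 < n.+1%:R by apply: truncnS_gtR.
have n1 : N <= 4 * n%:R by move: Nn; rewrite -[n.+1%:R]natr1; lra.
have n0 : (0 < n)%N by rewrite -(ltr0n R); lra.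
have lnN : 0 <= ln N by rewrite ln_ge0 //; lra.
have pi_ge : (size (primes_le (2 * n)) <= prime_pi N)%N.
  rewrite /prime_pi; apply: uniq_leq_size; first exact: primes_le_uniq.
  move=> p; rewrite mem_primes_le => /andP[pp pn].
  have pN : p%:R <= N by apply: le_trans nN; rewrite -natrM ler_nat.
  rewrite /primes_upto !inE /= pp pN andbT mem_iota /= ltnS.
  by rewrite (prime_gt0 pp) andbT orbC truncn_ge_nat ?pN // ltW.
have C : expR (n%:R / 2) <= N ^+ prime_pi N.
  apply: (le_trans (y := 2 ^+ n)); first exact: expR_le_exp2.
  have := central_bin_primes n0; rewrite -(ler_nat R) !natrX => /le_trans; apply.
  apply: (le_trans (y := N ^+ size (primes_le (2 * n)))).
    by rewrite lerXn2r ?nnegrE ?ler0n ?(ltW N0) // natrM.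
  by apply: ler_weXn2l pi_ge; lra.
have : n%:R / 2 <= (prime_pi N)%:R * ln N.
  rewrite [leRHS]mulr_natl -lnXn // -(expRK (n%:R / 2)).
  by rewrite ler_ln ?posrE ?expR_gt0 ?exprn_gt0.
lra.
Qed.

End Growth.

(* Here x stands for (log N)^c with c = 1 / Q, so that log N = x ^ Q, B <= exp x,
   eps = x ^- E, and x ^ h is the total loss of the sieve bound for t-tuples. *)
Section ParameterChoice.
Variables (R : realType) (t h E Q : nat) (x : R).
Hypothesis t_gt0 : (0 < t)%N.
Hypothesis h_def : h = (7 * t + 1)%N.
Hypothesis E_def : E = (2 * h + 2)%N.
Hypothesis Q_def : Q = (E + 2 * t + 10)%N.
Hypothesis x_ge100 : 100 <= x.
Hypothesis x_ge_t : t%:R ^+ 2 * 4 ^+ t.+1 <= x.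
Hypothesis x_ge_2t : 3 * 2 ^+ t <= x.
Hypothesis x_exp : (4 + 4 * t%:R + expR (12 * t%:R) * 3 ^+ (8 * t)) *
  x ^+ (9 * (t * Q) + 2 * Q + E + 5) <= expR x.
Hypothesis x_log : expR 16 * (4 * Q%:R * ln x) ^+ 4 <= x.
Hypothesis lnx_ge1 : 1 <= ln x.

Local Ltac degree := move: t_gt0 h_def E_def Q_def; clear; lia.

Let x1 : 1 <= x. Proof. by move: x_ge100; lra. Qed.
Let x0 : 0 < x. Proof. by move: x_ge100; lra. Qed.
Let xn1 n : 1 <= x ^+ n. Proof. exact: exprn_ege1. Qed.
Let xn0 n : 0 < x ^+ n. Proof. exact: exprn_gt0. Qed.
Let xmono m n : (m <= n)%N -> x ^+ m <= x ^+ n.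
Proof. by move=> mn; apply: ler_weXn2l. Qed.

(** Repackages [x_exp], so that one largeness condition serves many comparisons of a power of [x]
    with [expR x]. *)
Lemma monomial_le_exp (c : R) (d : nat) : 0 <= c ->
  c <= 4 + 4 * t%:R + expR (12 * t%:R) * 3 ^+ (8 * t) ->
  (d <= 9 * (t * Q) + 2 * Q + E + 5)%N -> c * x ^+ d <= expR x.
Proof.
move=> c0 cC dD; apply: le_trans x_exp.
apply: ler_pM => //; [exact: ltW | exact: xmono].
Qed.

Let C_ge4 : 4 <= 4 + 4 * t%:R + expR (12 * t%:R) * 3 ^+ (8 * t) :> R.
Proof.
by rewrite -addrA lerDl addr_ge0 ?mulr_ge0 ?ler0n ?expR_ge0 ?exprn_ge0.
Qed.

(** [K] makes the boundary loss at most [eps], and [J] steps suffice to exhaust the density. The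
    depth [s] makes [4 ^- s] beat every fixed power of [x], while [Z ^ s] stays far below [N]. The
    size of the discriminant fixes [l], and [y] keeps [l / y] bounded. *)
Let K := (Num.truncn (x ^+ E)).+1.
Let J := (Num.truncn (x ^+ E.+1)).+1.
Let s := (2 * Num.truncn (x ^+ 2)).+1.
Let Z := Num.truncn (expR (x ^+ (Q - 4))).
Let y := (Num.truncn (x ^+ Q)).+1.
Let l := (Num.truncn (4 * x ^+ Q)).+1.
Let e1 := x ^- (t * (Q - 5)).
Let rho0 := x ^- (Q + 2).
Let eps := x ^- E.

Lemma step_size_le (Bn : nat) : Bn%:R <= expR x -> (2 * (Bn * K))%:R <= expR (2 * x).
Proof.
move=> BnB; have -> : expR (2 * x) = expR x * expR x.
  by rewrite -expRD; congr expR; ring.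
rewrite mulnCA natrM; apply: ler_pM; rewrite ?ler0n // natrM.
apply: (le_trans (y := 4 * x ^+ E)).
  by have := truncnS_le2 (xn1 E); rewrite -/K; lra.
by apply: monomial_le_exp; [|exact: C_ge4|degree].
Qed.

Lemma steps_le (Bn : nat) : Bn%:R <= expR x ->
  ((2 * (Bn * K)) ^ J.+1)%:R <= expR (6 * x ^+ (E + 2)).
Proof.
move=> BnB; rewrite natrX; apply: (le_trans (y := expR (2 * x) ^+ J.+1)).
  by rewrite lerXn2r ?nnegrE ?expR_ge0 ?ler0n // step_size_le.
rewrite -expRM_natl ler_expR.
have -> : 6 * x ^+ (E + 2) = 3 * x ^+ E.+1 * (2 * x) by rewrite addn2 !exprS; ring.
rewrite ler_wpM2r ?mulr_ge0 ?(ltW x0) // -natr1.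
have := truncnS_le2 (xn1 E.+1); rewrite -/J; have := xn1 E.+1; lra.
Qed.

Lemma J_large_param : 1 < (1 + eps) ^+ J * rho0.
Proof.
have e0 : 0 < eps by rewrite invr_gt0.
have e1' : eps <= 1 by rewrite invf_le1.
rewrite /rho0 ltr_pdivlMr // mul1r.
apply: lt_le_trans (expR_le_exp_1D J (ltW e0) e1').
have Je : x / 2 <= J%:R * (eps / 2).
  rewrite mulrA ler_pM2r ?invr_gt0 // /eps ler_pdivlMr // -exprS.
  by apply: ltW; apply: truncnS_gtR; rewrite ltW.
apply: (lt_le_trans (y := expR (x / 2))); last by rewrite ler_expR.
have e2 : expR x = expR (x / 2) ^+ 2.
  by rewrite -expRM_natl; congr expR; field.
have : x ^+ (2 * (Q + 2)).+1 <= expR x.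
  rewrite -[leLHS]mul1r; apply: monomial_le_exp; [exact: ler01| |degree].
  by apply: le_trans C_ge4; lra.
rewrite e2 => H.
rewrite -(ltr_pXn2r (n := 2)) ?nnegrE ?expR_ge0 ?ltW //.
apply: lt_le_trans H; rewrite -exprM mulnC exprS ltr_pMl //.
by move: x_ge100; lra.
Qed.

Lemma n0_large_param (Bn : nat) (N : R) : Bn%:R <= expR x -> N = expR (x ^+ Q) ->
  ((2 * (Bn * K)) ^ J.+1 <= (Num.truncn N).+1)%N.
Proof.
move=> BnB NE; rewrite -(ler_nat R); apply: le_trans (steps_le BnB) _.
apply: ltW; apply: le_lt_trans (truncnS_gtR (_ : 0 <= N)); last by rewrite NE expR_ge0.
rewrite NE ler_expR.
have -> : Q = (E + 2 + (Q - E - 2))%N by degree.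
rewrite [leRHS]exprD mulrC ler_pM2l //.
apply: le_trans (_ : x ^+ 1 <= _); first by rewrite expr1; move: x_ge100; lra.
by apply: xmono; degree.
Qed.

Lemma D_small_param (Bn : nat) (N : R) : Bn%:R <= expR x -> N = expR (x ^+ Q) ->
  ((Num.truncn N).+1 * Bn ^ (t * t) < 2 ^ l)%N.
Proof.
move=> BnB NE; rewrite -(ltr_nat R) natrM !natrX.
have N1 : 1 <= N by rewrite NE -expR0 ler_expR ltW.
apply: (le_lt_trans (y := expR (2 * x ^+ Q))); last first.
  have -> : 2 * x ^+ Q = (4 * x ^+ Q) / 2 by field.
  apply: lt_le_trans (expR_le_exp2 (lexx l%:R)).
  rewrite ltr_expR ltr_pM2r ?invr_gt0 //; apply: truncnS_gtR.
  by rewrite mulr_ge0 // ltW.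
apply: (le_trans (y := 2 * N * expR x ^+ (t * t))).
  apply: ler_pM; rewrite ?ler0n ?exprn_ge0 ?truncnS_le2 //.
  by rewrite lerXn2r ?nnegrE ?ler0n ?expR_ge0.
rewrite -expRM_natl NE.
have two : 2 <= expR x by apply: le_trans (expR_ge1Dx x); move: x_ge100; lra.
apply: (le_trans (y := expR x * expR (x ^+ Q) * expR ((t * t)%:R * x))).
  by rewrite !ler_wpM2r ?expR_ge0.
rewrite -!expRD ler_expR.
have : x + (t * t)%:R * x <= x ^+ Q.
  apply: (le_trans (y := x ^+ 2 + x ^+ 2)).
    have tx : (t * t)%:R <= x.
      apply: le_trans x_ge_t; rewrite natrM -expr2 ler_peMr ?sqr_ge0 //.
      by apply: exprn_ege1; lra.
    apply: lerD; first by have := xmono (leqW (leqnn 1)); rewrite expr1.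
    by rewrite expr2 ler_pM2r.
  apply: (le_trans (y := x * x ^+ 2)).
    by rewrite -mulr2n -[leLHS]mulr_natl ler_pM2r //; move: x_ge100; lra.
  by rewrite -exprS; apply: xmono; degree.
lra.
Qed.

(** The sieve remainder and the total shrinking of the progression are each at most about
    [expR (6 * x ^+ (Q - 2))], negligible against [N = expR (x ^+ Q)]. *)
Lemma sieve_err_param (Bn : nat) (N : R) : Bn%:R <= expR x -> N = expR (x ^+ Q) ->
  ((1 + t * Z.+1) ^ s + t * Z.+1)%:R * ((2 * (Bn * K)) ^ J)%:R <=
    e1 * (Num.truncn N).+1%:R.
Proof.
move=> BnB NE.
have N0 : 0 <= N by rewrite NE expR_ge0.
have Q6 : (6 <= Q)%N by degree.
have EQ : (E + 2 <= Q - 2)%N by degree.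
have z1 : 1 <= expR (x ^+ (Q - 4)) by rewrite -expR0 ler_expR ltW.
have zx : expR x <= expR (x ^+ (Q - 4)).
  by rewrite ler_expR -{1}[x]expr1; apply: xmono; degree.
have Zle : (1 + t * Z.+1)%:R <= expR (2 * x ^+ (Q - 4)).
  rewrite natrD natrM.
  have -> : expR (2 * x ^+ (Q - 4)) = expR (x ^+ (Q - 4)) * expR (x ^+ (Q - 4)).
    by rewrite -expRD; congr expR; ring.
  apply: (le_trans (y := expR x * expR (x ^+ (Q - 4)))); last by rewrite ler_wpM2r ?expR_ge0.
  apply: (le_trans (y := 4 * t%:R * expR (x ^+ (Q - 4)))); last first.
    rewrite ler_wpM2r ?expR_ge0 // -[leLHS]mulr1 -(expr0 x); apply: monomial_le_exp; [by rewrite mulr_ge0 ?ler0n| |by []].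
    by rewrite addrAC lerDr addr_ge0 ?mulr_ge0 ?expR_ge0 ?exprn_ge0.
  have := truncnS_le2 z1; rewrite -/Z => H.
  have T1 : 1 <= t%:R :> R by rewrite ler1n.
  have : t%:R * Z.+1%:R <= t%:R * (2 * expR (x ^+ (Q - 4))) by rewrite ler_wpM2l.
  have : 1 <= t%:R * expR (x ^+ (Q - 4)) by rewrite mulr_ege1.
  set a := t%:R * _; have -> : t%:R * (2 * expR (x ^+ (Q - 4))) = 2 * a by rewrite /a; ring.
  have -> : 4 * t%:R * expR (x ^+ (Q - 4)) = 4 * a by rewrite /a; ring.
  rewrite -/a; lra.
have sle : s%:R <= 3 * x ^+ 2.
  rewrite /s -natr1 natrM; have := truncn_leR (ltW (xn0 2)); have := xn1 2; lra.
have pw : ((1 + t * Z.+1) ^ s + t * Z.+1)%:R <= expR x * expR (6 * x ^+ (Q - 2)).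
  apply: (le_trans (y := 2 * ((1 + t * Z.+1) ^ s)%:R)).
    rewrite -[2]/(2%:R) -natrM ler_nat mul2n -addnn leq_add2l.
    by rewrite /s expnS; apply: leq_trans (leq_pmulr _ _); rewrite ?leq_addl // expn_gt0.
  apply: ler_pM; rewrite ?ler0n //.
    by apply: le_trans (expR_ge1Dx x); move: x_ge100; lra.
  rewrite natrX; apply: (le_trans (y := expR (2 * x ^+ (Q - 4)) ^+ s)).
    by rewrite lerXn2r ?nnegrE ?ler0n ?expR_ge0.
  rewrite -expRM_natl ler_expR.
  have -> : (Q - 2 = 2 + (Q - 4))%N by degree.
  have -> : 6 * x ^+ (2 + (Q - 4)) = 3 * x ^+ 2 * (2 * x ^+ (Q - 4)) by rewrite exprD; ring.
  by rewrite ler_wpM2r // mulr_ge0 // ltW.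
have stp : ((2 * (Bn * K)) ^ J)%:R <= expR (6 * x ^+ (Q - 2)).
  have B0 : (0 < Bn)%N \/ Bn = 0%N by case: (Bn) => [|?]; [right|left].
  case: B0 => [B0|->]; last first.
    by rewrite mul0n muln0 /J exp0n // expR_ge0.
  apply: (le_trans (y := ((2 * (Bn * K)) ^ J.+1)%:R)).
    by rewrite ler_nat leq_pexp2l // !muln_gt0 B0.
  apply: le_trans (steps_le BnB) _; rewrite ler_expR ler_pM2l //; exact: xmono.
apply: (le_trans (ler_pM (ler0n _ _) (ler0n _ _) pw stp)).
apply: (le_trans (y := e1 * N)); last first.
  by rewrite ler_wpM2l ?invr_ge0 ?exprn_ge0 // ?ltW // truncnS_gtR.
rewrite /e1 [leRHS]mulrC ler_pdivlMr // NE.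
apply: (le_trans (y := expR x * expR (6 * x ^+ (Q - 2)) * expR (6 * x ^+ (Q - 2)) * expR x)).
  rewrite ler_wpM2l ?mulr_ge0 ?expR_ge0 // -[leLHS]mul1r; apply: monomial_le_exp; [exact: ler01| |].
    by apply: le_trans C_ge4; lra.
  have : (t * (Q - 5) <= t * Q)%N by rewrite leq_mul2l leq_subr orbT.
  by move: (t * (Q - 5))%N (t * Q)%N; degree.
rewrite -!expRD ler_expR.
have xQ : x <= x ^+ (Q - 2) by rewrite -{1}[x]expr1; apply: xmono; degree.
have -> : Q = (2 + (Q - 2))%N by degree.
rewrite [leRHS]exprD addnC addnK.
apply: (le_trans (y := 14 * x ^+ (Q - 2))); first by lra.
rewrite ler_pM2r // expr2; apply: (le_trans (y := 100 * 1)); first by lra.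
by apply: ler_pM.
Qed.

(** As [y] is about a power of [x], its prime reciprocal sum is of order [ln (ln x)]; the
    exponential is then only a power of [ln x]. *)
Lemma prime_recip_y : expR (2 * (prime_recip R y + l%:R / y%:R)) <= x.
Proof.
have Q0 : 1 <= Q%:R :> R by rewrite ler1n; degree.
have ql1 : 1 <= 2 * Q%:R * ln x.
  rewrite -[1]mulr1; apply: ler_pM => //; lra.
set J1 := (Num.truncn (2 * Q%:R * ln x)).+1.
have J1lo : 2 * Q%:R * ln x < J1%:R by apply: truncnS_gtR; lra.
have J1hi : J1%:R <= 4 * Q%:R * ln x.
  by have := truncnS_le2 ql1; rewrite -/J1; lra.
have yJ : (y <= 2 ^ J1.+1)%N.
  rewrite -(ler_nat R) natrX exprS; apply: le_trans (truncnS_le2 (xn1 Q)) _.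
  rewrite ler_pM2l //; apply: le_trans (expR_le_exp2 (ltW J1lo)).
  have -> : 2 * Q%:R * ln x / 2 = Q%:R * ln x by field.
  by rewrite expRM_natl lnK ?posrE.
have S := prime_recip_le R (ltn0Sn _) yJ.
have y0 : 0 < y%:R :> R by rewrite ltr0Sn.
have ly : l%:R / y%:R <= 5 :> R.
  rewrite ler_pdivrMr // -[leLHS]natr1.
  have a : (Num.truncn (4 * x ^+ Q))%:R <= 4 * x ^+ Q by apply: truncn_leR; rewrite mulr_ge0 // ltW.
  have b : x ^+ Q < y%:R by apply: truncnS_gtR; rewrite ltW.
  by move: a b; have := xn1 Q; lra.
have J10 : 0 < J1%:R :> R by rewrite ltr0Sn.
apply: le_trans x_log.
apply: (le_trans (y := expR (16 + 4%:R * ln J1%:R))).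
  rewrite ler_expR; move: S ly; rewrite -/J1; lra.
rewrite expRD ler_pM2l ?expR_gt0 // expRM_natl lnK ?posrE //.
by rewrite lerXn2r ?nnegrE ?(ltW J10) ?(le_trans (ltW J10)).
Qed.

(** The reciprocal sum up to [Z] is of order [ln x], so the numerator is a fixed power of [x], while
    [4 ^+ s] is at least [expR x]. *)
Lemma prime_recip_Z :
  expR (4 * t%:R * prime_recip R Z) / 4 ^+ s <= e1.
Proof.
have xQ1 : 1 <= 2 * x ^+ Q by have := xn1 Q; lra.
set J2 := (Num.truncn (2 * x ^+ Q)).+1.
have J2lo : 2 * x ^+ Q < J2%:R by apply: truncnS_gtR; lra.
have J2hi : J2%:R <= 3 * x ^+ Q.
  rewrite /J2 -natr1; have := @truncn_leR R (2 * x ^+ Q) (le_trans ler01 xQ1).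
  have := xn1 Q; lra.
have ZJ : (Z <= 2 ^ J2.+1)%N.
  rewrite -(ler_nat R) natrX; apply: le_trans (truncn_leR (expR_ge0 _)) _.
  apply: (le_trans (y := 2 ^+ J2)); last by apply: ler_weXn2l => //; lra.
  apply: le_trans (expR_le_exp2 (ltW J2lo)).
  rewrite ler_expR [2 * _]mulrC mulfK //; apply: xmono; exact: leq_subr.
have S := prime_recip_le R (ltn0Sn _) ZJ.
have J20 : 0 < J2%:R :> R by rewrite ltr0Sn.
have four : expR x <= 4 ^+ s.
  apply: (le_trans (y := expR (((2 * s)%:R) / 2))).
    rewrite ler_expR natrM [2 * _]mulrC mulfK //.
    apply: (le_trans (y := x ^+ 2)); first by rewrite -{1}[x]expr1; apply: xmono.
    have a : x ^+ 2 < (Num.truncn (x ^+ 2)).+1%:R by apply: truncnS_gtR; rewrite ltW.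
    rewrite (le_trans (ltW a)) // ler_nat /s; clear; lia.
  by apply: (le_trans (expR_le_exp2 (lexx _))); rewrite exprM -natrX.
rewrite ler_pdivrMr ?exprn_gt0 // /e1 [leRHS]mulrC ler_pdivlMr //.
apply: le_trans four; apply: le_trans x_exp.
have M : expR (4 * t%:R * prime_recip R Z) <= expR (12 * t%:R) * 3 ^+ (8 * t) * x ^+ (8 * (t * Q)).
  apply: (le_trans (y := expR (12 * t%:R + (8 * t)%:R * ln J2%:R))).
    rewrite ler_expR natrM.
    have -> : 12 * t%:R + 8 * t%:R * ln J2%:R = 4 * t%:R * (3 + 2 * ln J2%:R) :> R by ring.
    by rewrite ler_wpM2l // mulr_ge0.
  rewrite expRD -mulrA ler_pM2l ?expR_gt0 // expRM_natl lnK ?posrE //.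
  have -> : (8 * (t * Q) = Q * (8 * t))%N by clear; lia.
  by rewrite [x ^+ (_ * _)]exprM -exprMn lerXn2r ?nnegrE ?mulr_ge0 ?ler0n ?(ltW (xn0 _)).
apply: (le_trans (ler_wpM2r (ltW (xn0 _)) M)).
rewrite -[leLHS]mulrA -exprD; apply: ler_pM; rewrite ?mulr_ge0 ?expR_ge0 ?exprn_ge0 //.
- exact: ltW.
- by rewrite lerDr addr_ge0 ?mulr_ge0.
apply: xmono.
have : (t * (Q - 5) <= t * Q)%N by rewrite leq_mul2l leq_subr orbT.
by move: (t * (Q - 5))%N (t * Q)%N; degree.
Qed.

(** Each of the three terms is at most [e1]. Passing from exponent [t * (Q - 5)] to [t * (Q + 2)]
    costs [x ^+ (7 * t)], and one more factor [x] pays for [3 * 2 ^+ t]; hence the value of [h]. *)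
Lemma sieve_main_param :
  (expR (2 * (prime_recip R y + l%:R / y%:R)) / ln Z.+1%:R) ^+ t +
    expR (4 * t%:R * prime_recip R Z) / 4 ^+ s + e1 <= x ^+ h * (rho0 / 2) ^+ t.
Proof.
have first : (expR (2 * (prime_recip R y + l%:R / y%:R)) / ln Z.+1%:R) ^+ t <= e1.
  have lnZ : x ^+ (Q - 4) <= ln Z.+1%:R.
    rewrite -[leLHS]expRK ler_ln ?posrE ?expR_gt0 ?ltr0Sn //.
    by apply: ltW; apply: truncnS_gtR; exact: expR_ge0.
  have lnZ0 : 0 < ln Z.+1%:R :> R by apply: lt_le_trans lnZ.
  rewrite /e1 mulnC exprM -exprVn lerXn2r ?nnegrE ?divr_ge0 ?expR_ge0 ?invr_ge0 ?(ltW lnZ0) ?(ltW (xn0 _)) //.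
  rewrite ler_pdivrMr //; apply: le_trans prime_recip_y _.
  rewrite mulrC ler_pdivlMr // -exprS.
  by have -> : ((Q - 5).+1 = Q - 4)%N by degree.
have second := prime_recip_Z.
apply: (le_trans (y := 3 * e1)); first by move: first second; lra.
have -> : (rho0 / 2) ^+ t = (x ^+ ((Q + 2) * t) * 2 ^+ t)^-1.
  by rewrite /rho0 -invfM exprVn exprMn -exprM.
rewrite ler_pdivlMr ?mulr_gt0 ?exprn_gt0 // /e1 mulrAC ler_pdivrMr //.
have -> : x ^+ h * x ^+ (t * (Q - 5)) = x * x ^+ ((Q + 2) * t).
  by rewrite -exprD -exprS; congr (_ ^+ _); degree.
have -> : 3 * (x ^+ ((Q + 2) * t) * 2 ^+ t) = 3 * 2 ^+ t * x ^+ ((Q + 2) * t) by ring.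
by rewrite ler_pM2r.
Qed.

Lemma V_large_param (v : R) : x ^+ (Q ^ 2) / 4 <= v ->
  1 <= 3 * eps * (v * (rho0 / 2) ^+ 2) /\ (t ^ 2)%:R <= v * (rho0 / 2) ^+ (2 * t).
Proof.
move=> vl; split.
  apply: (le_trans (y := 3 * eps * (x ^+ (Q ^ 2) / 4 * (rho0 / 2) ^+ 2))); last first.
    rewrite ler_pM2l ?ler_pM2r ?mulr_gt0 ?invr_gt0 ?exprn_gt0 //.
  rewrite exprMn /rho0 exprVn -exprM /eps.
  have -> : 3 * x ^- E * (x ^+ (Q ^ 2) / 4 * (x ^- ((Q + 2) * 2) * 2^-1 ^+ 2)) =
     (3 / 16) * (x ^+ (Q ^ 2) / (x ^+ E * x ^+ ((Q + 2) * 2))).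
    by field; rewrite !gt_eqF.
  rewrite -exprD.
  have -> : (Q ^ 2 = E + (Q + 2) * 2 + (Q ^ 2 - (E + (Q + 2) * 2)))%N.
    by rewrite subnKC //; move: t_gt0 h_def E_def Q_def; clear; nia.
  rewrite [x ^+ (_ + (_ - _))]exprD [_ * x ^+ (Q ^ 2 - _)]mulrC mulfK ?gt_eqF //.
  apply: (le_trans (y := 3 / 16 * x ^+ 1)); first by rewrite expr1; move: x_ge100; lra.
  by rewrite ler_pM2l ?divr_gt0 //; apply: xmono; move: t_gt0 h_def E_def Q_def; clear; nia.
apply: (le_trans (y := x ^+ (Q ^ 2) / 4 * (rho0 / 2) ^+ (2 * t))); last first.
  by rewrite ler_pM2r // exprn_gt0 // divr_gt0 // invr_gt0.
rewrite exprMn /rho0 exprVn -exprM natrX.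
have -> : x ^+ (Q ^ 2) / 4 * (x ^- ((Q + 2) * (2 * t)) * 2^-1 ^+ (2 * t)) =
   x ^+ (Q ^ 2) / x ^+ ((Q + 2) * (2 * t)) / (4 ^+ t.+1).
  rewrite exprVn [2 ^+ _]exprM -natrX exprS; field.
  by rewrite gt_eqF //= gt_eqF // exprn_gt0.
rewrite ler_pdivlMr ?exprn_gt0 //; apply: le_trans x_ge_t _.
rewrite ler_pdivlMr // -exprS; apply: xmono; move: t_gt0 h_def E_def Q_def; clear; nia.
Qed.

End ParameterChoice.

(** * From the chosen parameters to the count of bad tuples *)

Section Assembly.
Variables (R : realType) (k h E Q : nat) (x N B : R) (A : {fset nat}).
Let t := (2 * k.-1)%N.
Hypothesis k_gt1 : (1 < k)%N.
Hypothesis h_def : h = (7 * t + 1)%N.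
Hypothesis E_def : E = (2 * h + 2)%N.
Hypothesis Q_def : Q = (E + 2 * t + 10)%N.
Hypothesis x_ge100 : 100 <= x.
Hypothesis x_ge_t : t%:R ^+ 2 * 4 ^+ t.+1 <= x.
Hypothesis x_ge_2t : 3 * 2 ^+ t <= x.
Hypothesis x_exp : (4 + 4 * t%:R + expR (12 * t%:R) * 3 ^+ (8 * t)) *
  x ^+ (9 * (t * Q) + 2 * Q + E + 5) <= expR x.
Hypothesis x_log : expR 16 * (4 * Q%:R * ln x) ^+ 4 <= x.
Hypothesis lnx_ge1 : 1 <= ln x.
Hypothesis N_def : N = expR (x ^+ Q).
Hypothesis B_ge : x ^+ (Q ^ 2) <= B.
Hypothesis B_le : B <= expR x.
Hypothesis A_primes : (A `<=` primes_upto N)%fset.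
Hypothesis A_dense : (prime_pi N)%:R / x <= #|` A|%fset%:R.

Let Bn := Num.truncn B.
Let V : {set 'I_Bn.+1} :=
  [set b : 'I_Bn.+1 | (B / 2 < (b : nat)%:R) && ((b : nat)%:R <= B)]%SET.

Let x0 : 0 < x. Proof. by move: x_ge100; lra. Qed.
Let x1 : 1 <= x. Proof. by move: x_ge100; lra. Qed.
Let xn1 n : 1 <= x ^+ n. Proof. exact: exprn_ege1. Qed.
Let xn0 n : 0 < x ^+ n. Proof. exact: exprn_gt0. Qed.

Let xE100 n : (0 < n)%N -> 100 <= x ^+ n.
Proof. by move=> n0; apply: le_trans x_ge100 _; rewrite -{1}[x]expr1; apply: ler_weXn2l. Qed.

Let B_ge100 : 100 <= B.
Proof.
by apply: le_trans B_ge; apply: xE100; rewrite expn_gt0 Q_def addn_gt0 orbT.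
Qed.

Let B0 : 0 <= B. Proof. by move: B_ge100; lra. Qed.

Lemma dyadic_tuplesE : dyadic_tuples k B = tuple_on V k.
Proof. by apply/setP => b; rewrite !inE; apply: eq_forallb => i; rewrite inE. Qed.

Lemma card_dyadic_ge : x ^+ (Q ^ 2) / 4 <= #|V|%:R.
Proof.
set m := Num.truncn (B / 2).
have B20 : 0 <= B / 2 by rewrite divr_ge0.
have mB : m%:R <= B / 2 by apply: truncn_leR.
have BB : B < Bn.+1%:R by apply: truncnS_gtR.
have mBn : (m <= Bn)%N by apply: le_truncn; rewrite ler_pdivrMr //; move: B_ge100; lra.
have V_ge : (Bn - m <= #|V|)%N.
  have <- : (\sum_(m.+1 <= b < Bn.+1) 1 = Bn - m)%N by rewrite sum_nat_const_nat muln1 subSS.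
  apply: (@leq_trans (\sum_(0 <= b < Bn.+1 | (m < b)%N) 1)%N).
    rewrite [leqRHS]big_mkcond [leqRHS](big_cat_nat (n := m.+1)) //=.
    apply: leq_trans (leq_addl _ _).
    by rewrite big_seq [leqRHS]big_seq; apply: leq_sum => b; rewrite mem_index_iota => /andP[-> _].
  rewrite big_mkord sum1_card; apply: subset_leq_card; apply/fintype.subsetP => b.
  rewrite !inE unfold_in /= => mb.
  have bB : (b <= Bn)%N by rewrite -ltnS.
  rewrite -truncn_ge_nat // bB andbT.
  apply: lt_le_trans (truncnS_gtR B20) _; by rewrite ler_nat.
move: V_ge; rewrite -(ler_nat R) natrB // => V_ge.
apply: le_trans V_ge; move: BB; rewrite -[Bn.+1%:R]natr1.
move: B_ge B_ge100 mB; lra.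
Qed.

Let tr_le2 : (Num.truncn N).+1%:R <= 2 * N.
Proof. by apply: truncnS_le2; rewrite N_def -expR0 ler_expR ltW. Qed.

Let N0 : 0 < N. Proof. by rewrite N_def expR_gt0. Qed.

(** Chebyshev's bound gives relative density of order [x ^- (Q + 1)]; the last factor [x] absorbs
    the constant 16. *)
Lemma dense_param :
  x ^- (Q + 2) * (Num.truncn N).+1%:R <=
    (ap_count [pred p | p \in A] 0 1 (Num.truncn N).+1)%:R.
Proof.
have cA : (#|` A|%fset <= ap_count [pred p | p \in A] 0 1 (Num.truncn N).+1)%N.
  have -> : ap_count [pred p | p \in A] 0 1 (Num.truncn N).+1 =
      size [seq p <- iota 0 (Num.truncn N).+1 | p \in A].
    rewrite size_filter -sum1_count [RHS]big_mkcond /ap_count.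
    rewrite -[X in iota 0 X]subn0 -/(index_iota _ _) big_mkord; apply: eq_bigr => i _.
    by rewrite add0n mul1n /=; case: (_ \in _).
  apply: uniq_leq_size; first exact: fset_uniq.
  move=> p pA; rewrite mem_filter pA /=.
  by have := fsubsetP A_primes p pA; rewrite /primes_upto !inE /= => /andP[].
have N8 : 8 <= N.
  rewrite N_def; apply: le_trans (expR_ge1Dx _).
  have := xE100 (_ : (0 < Q)%N); rewrite Q_def addn_gt0 orbT => /(_ isT); lra.
have P := prime_pi_ge N8; rewrite {2}N_def expRK in P.
apply: (le_trans (y := #|` A|%fset%:R)); last by rewrite ler_nat.
apply: le_trans A_dense.
rewrite ler_pdivlMr // -mulrA mulrC ler_pdivrMr //.
apply: (le_trans (y := 2 * N * x)); first by rewrite ler_pM2r.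
apply: (le_trans (y := 2 * (8 * x ^+ Q * (prime_pi N)%:R) * x)).
  by rewrite ler_pM2r // ler_pM2l.
have -> : 2 * (8 * x ^+ Q * (prime_pi N)%:R) * x = 16 * (x * x ^+ Q * (prime_pi N)%:R) by ring.
have -> : (prime_pi N)%:R * x ^+ (Q + 2) = x * (x * x ^+ Q * (prime_pi N)%:R).
  by rewrite addn2 !exprS; ring.
rewrite ler_wpM2r ?mulr_ge0 ?ler0n ?(ltW x0) ?(ltW (xn0 _)) //.
by move: x_ge100; lra.
Qed.

Lemma bad_tuples_le :
  #|bad_tuples k A N B|%:R <= (7 * k%:R) * x^-1 * #|dyadic_tuples k B|%:R.
Proof.
have t_gt0 : (0 < t)%N by rewrite /t; move: k_gt1; clear; lia.
have BnB : Bn%:R <= expR x by apply: le_trans B_le; apply: truncn_leR.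
have Bn0 : (0 < Bn)%N by rewrite truncn_gt0; move: B_ge100; lra.
have A_pr p : [pred p | p \in A] p -> prime p.
  by move=> /= /(fsubsetP A_primes); rewrite /primes_upto !inE /= => /andP[_ /andP[]].
have Vl := card_dyadic_ge.
have V0 : (0 < #|V|)%N.
  by rewrite -(ltr0n R); apply: lt_le_trans Vl; rewrite divr_gt0.
have E0 : (0 < E)%N by rewrite E_def addn_gt0 orbT.
have [VL VLt] := V_large_param t_gt0 h_def E_def Q_def x_ge100 x_ge_t Vl.
have eps_gt0 : 0 < x ^- E by rewrite invr_gt0.
have eps_le : 3 * x ^- E <= 1.
  by rewrite ler_pdivrMr // mul1r; have := xE100 E0; lra.
set K := (Num.truncn (x ^+ E)).+1.
have Klt : x ^+ E < K%:R by apply: truncnS_gtR; apply: ltW.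
have K_large : 1 <= x ^- E * K%:R by rewrite mulrC ler_pdivlMr // mul1r ltW.
have K4 : (4 <= K)%N.
  by rewrite -(ler_nat R); apply: le_trans (ltW Klt); have := xE100 E0; lra.
have Z0 : (0 < Num.truncn (expR (x ^+ (Q - 4))))%N.
  by rewrite truncn_gt0 -expR0 ler_expR ltW.
have s_odd : odd (2 * Num.truncn (x ^+ 2)).+1 by rewrite /= oddM.
have rho0_gt0 : 0 < x ^- (Q + 2) by rewrite invr_gt0.
(* Here [H = x ^+ h] and [u = x ^+ (2 * h + 1)], so [E = 2 * h + 2] makes both [u * eps] and
   [H ^+ 2 / u] equal to [x^-1]. *)
have [bad [bad_sub bad_le good]] :=
  few_tuples_without_config A_pr k_gt1 Bn0 (ltn0Sn _) Z0 s_odd rho0_gt0 eps_gt0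
    eps_le K_large (xn1 h) (xn0 (2 * h + 1))
    (n0_large_param t_gt0 h_def E_def Q_def x_ge100 x_exp BnB N_def)
    (J_large_param t_gt0 h_def E_def Q_def x_ge100 x_exp)
    dense_param V0 VL VLt
    (D_small_param t_gt0 h_def E_def Q_def x_ge100 x_ge_t BnB N_def)
    (sieve_err_param t_gt0 h_def E_def Q_def x_ge100 x_exp BnB N_def)
    (sieve_main_param t_gt0 h_def E_def Q_def x_ge100 x_ge_2t x_exp x_log lnx_ge1).
apply: (le_trans (y := #|bad|%:R)).
  rewrite ler_nat; apply: subset_leq_card; apply/fintype.subsetP => b.
  rewrite inE dyadic_tuplesE => /andP[bV noconf].
  apply: contraT => nbad; case/negP: noconf; apply/asboolP.
  have [z [m [m0 mN conf]]] := good b bV nbad.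
  exists z, m; split=> //.
  (* [K >= 4] compensates two factors of 2, from [B <= 2 * Bn] and from
     [Num.truncn N + 1 <= 2 * N]. *)
  rewrite ler_pdivlMr; last by move: B_ge100; lra.
  have BB : B <= 2 * Bn%:R.
    have : B < Bn.+1%:R by apply: truncnS_gtR.
    have : 1 <= Bn%:R :> R by rewrite ler1n.
    rewrite -[Bn.+1%:R]natr1; lra.
  apply: (le_trans (y := m%:R * (2 * Bn%:R))); first by rewrite ler_wpM2l ?ler0n.
  have : (m * (Bn * 4))%:R <= (Num.truncn N).+1%:R :> R.
    rewrite ler_nat; apply: leq_trans mN.
    by rewrite !leq_mul2l K4 !orbT.
  rewrite !natrM; move: tr_le2; lra.
apply: le_trans bad_le _.
rewrite dyadic_tuplesE card_tuple_on natrX.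
rewrite ler_wpM2r ?exprn_ge0 ?ler0n //.
have -> : 7 * k%:R * x^-1 = k%:R * (7 * x^-1) by ring.
rewrite ler_wpM2l ?ler0n //.
have -> : 6 * x ^+ (2 * h + 1) * x ^- E = 6 * x^-1.
  have -> : x ^+ E = x * x ^+ (2 * h + 1) by rewrite -exprS; congr (_ ^+ _); rewrite E_def addnS.
  by field; rewrite !gt_eqF.
have -> : (x ^+ h) ^+ 2 / x ^+ (2 * h + 1) = x^-1.
  rewrite -exprM mulnC addn1 exprS invfM mulrCA mulfV ?mulr1 // gt_eqF //.
have := x0; lra.
Qed.

End Assembly.

Theorem theorem1p2 (R : realType) (k : nat) (hk : (3 <= k)%N) :
  exists c : R, 0 < c /\
  exists C N0 : R,
  forall (N B : R) (A : {fset nat}),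
    N0 <= N ->
    (ln N) `^ (1 / c) <= B ->
    B <= expR ((ln N) `^ c) ->
    (A `<=` primes_upto N)%fset ->
    (prime_pi N)%:R / (ln N) `^ c <= (#|` A|%fset)%:R ->
    #|bad_tuples k A N B|%:R <= C * (ln N) `^ (- c) * #|dyadic_tuples k B|%:R.
Proof.
set t := (2 * k.-1)%N.
set h := (7 * t + 1)%N.
set E := (2 * h + 2)%N.
set Q := (E + 2 * t + 10)%N.
have Q0 : 0 < Q%:R :> R by rewrite ltr0n /Q addn_gt0 orbT.
have [y1 Hexp] := expR_dominates (4 + 4 * t%:R + expR (12 * t%:R) * 3 ^+ (8 * t) : R)
  (9 * (t * Q) + 2 * Q + E + 5).
have [y2 Hlog] := ln_dominated (expR 16 * (4 * Q%:R) ^+ 4 : R) 4.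
(* A sum of nonnegative terms, hence above every threshold at once. *)
pose x0 : R := 100 + t%:R ^+ 2 * 4 ^+ t.+1 + 3 * 2 ^+ t + `|y1| + `|y2| + expR 1.
have p1 : 0 <= t%:R ^+ 2 * 4 ^+ t.+1 :> R by rewrite mulr_ge0 ?exprn_ge0.
have p2 : 0 <= 3 * 2 ^+ t :> R by rewrite mulr_ge0 ?exprn_ge0.
have p3 := normr_ge0 y1; have p4 := normr_ge0 y2.
have p5 : 0 <= expR 1 :> R := expR_ge0 1.
have q1 := ler_norm y1; have q2 := ler_norm y2.
(* With [c = 1 / Q] and [x] the [c]-th power of [ln N], the lower bound for [B] reads
   [x ^+ (Q ^ 2)], large enough for [V_large_param]. *)
exists Q%:R^-1; split; first by rewrite invr_gt0.
exists (7 * k%:R), (expR (x0 ^+ Q)) => N B A N_ge.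
have N_gt0 : 0 < N by apply: lt_le_trans N_ge; apply: expR_gt0.
have L_ge : x0 ^+ Q <= ln N by rewrite -(expRK (x0 ^+ Q)) ler_ln ?posrE ?expR_gt0.
have x0_gt0 : 0 < x0 by rewrite /x0; lra.
have L_gt0 : 0 < ln N by apply: lt_le_trans L_ge; apply: exprn_gt0.
set x := ln N `^ Q%:R^-1.
have x_ge0 : 0 <= x := powR_ge0 _ _.
have xQ : x ^+ Q = ln N.
  by rewrite -powR_mulrn // -powRrM mulVf ?gt_eqF // powRr1 // ltW.
have x_ge : x0 <= x.
  by rewrite -(@ler_pXn2r _ Q) ?nnegrE ?(ltW x0_gt0) ?xQ // /Q addn_gt0 orbT.
have NE : N = expR (x ^+ Q) by rewrite xQ lnK.
rewrite div1r invrK powR_mulrn ?(ltW L_gt0) // powRN -/x -xQ -exprM.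
move=> B_ge B_le A_sub A_dense.
apply: (@bad_tuples_le R k h E Q x N B A) => //.
- by apply: leq_trans hk.
- by move: x_ge; rewrite /x0; lra.
- by move: x_ge; rewrite -/t /x0; lra.
- by move: x_ge; rewrite -/t /x0; lra.
- by apply: Hexp; move: x_ge; rewrite /x0; lra.
- rewrite exprMn mulrA; apply: Hlog; move: x_ge; rewrite /x0; lra.
- rewrite -(expRK 1) ler_ln ?posrE ?expR_gt0 //; last exact: lt_le_trans x_ge.
  by move: x_ge; rewrite /x0; lra.
Qed.
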